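(* For every integer $s\ge 2$, with $c(s)=12s+8$, we have $\delta_1(c(s))\le g_{min}(c(s))+3$.
   Context: A map is a simple connected graph together with a cellular embedding in a closed orientable surface. The dual $G^*$ of a map $G$ has the faces of $G$ as vertices and one edge for each edge of $G$, joining the faces on its two sides; it is simple if it has no loops or multiple edges. A $1$-cut is a vertex whose removal disconnects the graph. $g_{min}(c)$ is the minimum genus of an orientable surface on which a $c$-connected graph can be embedded; for $c\ge 6$ it equals $\lceil (c-2)(c-3)/12\rceil$. $\delta_1(c)$ is the smallest genus of an orientable surface on which there is a $c$-connected map whose dual is simple and has a $1$-cut. *)

(* Defs.v *)
(* MathComp world. *)
From mathcomp Require Import all_boot all_fingroup.
Set Implicit Arguments.
Unset Strict Implicit.
Unset Printing Implicit Defensive.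

Record sgraph := SGraph {
  svertex :> finType;
  sedge : rel svertex;
  sedge_sym : symmetric sedge;
  sedge_irr : irreflexive sedge }.

Definition giso (G H : sgraph) : Prop :=
  exists2 phi : G -> H, bijective phi
    & forall x y : G, sedge (phi x) (phi y) = sedge x y.

Definition remove_rel (G : sgraph) (S : {set G}) : rel G :=
  fun x y => [&& x \notin S, y \notin S & sedge x y].

(* The empty graph counts as connected here. *)
Definition connected_off (G : sgraph) (S : {set G}) : Prop :=
  forall x y : G, x \notin S -> y \notin S -> connect (remove_rel S) x y.

Definition gconnected (G : sgraph) : Prop :=
  0 < #|G| /\ connected_off (@set0 G).

Definition kconnected (k : nat) (G : sgraph) : Prop :=
  k < #|G| /\ forall S : {set G}, #|S| < k -> connected_off S.

Definition one_cut (G : sgraph) (x : G) : Prop := ~ connected_off [set x].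

(* Combinatorial map: a graph (possibly with loops and multiple edges) with a
   rotation system.  Darts are oriented edges, [edge] reverses a dart, and
   [node] sends a dart to the next one in the rotation around its origin; these
   are exactly the cellular embeddings in closed orientable surfaces of graphs
   without isolated vertices. *)
Record cmap := CMap {
  dart :> finType;
  edge : {perm dart};
  node : {perm dart};
  edge_invol : involutive edge;
  edge_free : forall d : dart, edge d != d }.

(* Face tracing is d |-> node (edge d), so [edge * face = node] and dualizing
   twice gives back the same map.  The edge of a dart d has on its two sides
   the faces of d and of [edge d]. *)
Definition face (M : cmap) : {perm M} := (edge M * node M)%g.

Definition dual (M : cmap) : cmap :=
  CMap (face M) (@edge_invol M) (@edge_free M).

Definition vertex (M : cmap) : finType :=
  {A : {set M} | A \in porbits (node M)}.

Fact porbit_mem (M : cmap) (d : M) : porbit (node M) d \in porbits (node M).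
Proof. exact: imset_f. Qed.

Definition origin (M : cmap) (d : M) : vertex M :=
  exist _ (porbit (node M) d) (porbit_mem d).

Definition ends (M : cmap) (d : M) : {set vertex M} :=
  [set origin d; origin (edge M d)].

Definition simple_map (M : cmap) : Prop :=
  (forall d : M, origin d <> origin (edge M d)) /\
  (forall d d' : M, ends d = ends d' ->
     porbit (edge M) d = porbit (edge M) d').

Definition vadj (M : cmap) : rel (vertex M) :=
  fun x y => (x != y) &&
    [exists d : M, (origin d == x) && (origin (edge M d) == y)].

Fact vadj_sym (M : cmap) : symmetric (@vadj M).
Proof.
move=> x y; rewrite /vadj eq_sym; congr (_ && _).
by apply/existsP/existsP => -[d /andP[/eqP dx /eqP dy]];
  exists (edge M d); rewrite edge_invol dx dy !eqxx.
Qed.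

Fact vadj_irr (M : cmap) : irreflexive (@vadj M).
Proof. by move=> x; rewrite /vadj eqxx. Qed.

(* Loops and multiplicities are forgotten, so nothing is lost when
   [simple_map M] holds. *)
Definition graph_of (M : cmap) : sgraph := SGraph (@vadj_sym M) (@vadj_irr M).

Definition is_map (M : cmap) : Prop := gconnected (graph_of M) /\ simple_map M.

(* Euler's formula V - E + F = 2 - 2g for a connected M. *)
Definition has_genus (M : cmap) (g : nat) : Prop :=
  #|vertex M| + #|vertex (dual M)| + 2 * g = #|porbits (edge M)| + 2.

(* Embeddability, not necessarily cellular, of a connected graph with an edge
   in the closed orientable surface of genus g: it amounts to a cellular
   embedding in some surface of genus h <= g, since a noncellular embedding can
   be made cellular by cutting along essential curves in faces and capping off,
   and conversely one can add handles inside a face. *)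
Definition embeds (G : sgraph) (g : nat) : Prop :=
  exists (M : cmap) (h : nat),
    [/\ is_map M, has_genus M h, h <= g & giso G (graph_of M)].

Definition is_least (P : nat -> Prop) (g : nat) : Prop :=
  P g /\ forall h : nat, P h -> g <= h.

Definition is_gmin (c : nat) : nat -> Prop :=
  is_least (fun g => exists G : sgraph, kconnected c G /\ embeds G g).

Definition is_delta1 (c : nat) : nat -> Prop :=
  is_least (fun g => exists M : cmap,
    [/\ is_map M, has_genus M g, kconnected c (graph_of M),
        simple_map (dual M) & exists f : graph_of (dual M), one_cut f]).

(* Main.v *)
(* A c-connected graph of genus g has at least c + 1 vertices, all of degree at
   least c, so Euler's formula gives 12 g >= (c - 2)(c - 3), that is
   g_min(c(s)) >= 12 s^2 + 11 s + 3.  It remains to embed the complete graph on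
   n = c(s) + 1 = 12 s + 9 vertices in genus 12 s^2 + 11 s + 6 so that the dual is
   simple and has a 1-cut.

   A current graph over Z_(12s+2) (a ladder with 2 s - 4 rungs closed by a fixed
   gadget, with three vortices of degree one and two of degree two) has a single
   log, and yields a triangular embedding of K_n - K_7 of genus 12 s^2 + 11 s - 1;
   the seven pairwise nonadjacent vertices are called letters.  Permuting cyclically
   the seven arcs between the letters in the rotation at vertex 0 merges seven
   triangles into a single face of length 21 through all letters (three handles).
   Four chords of that face join letters, and the other 17 edges of K_7 form a map on
   the torus with nine triangles and a heptagon through all letters.  Gluing the
   heptagon to the large face along the seven letters (four more handles) leaves one
   face of length 20 around the letters.  Its removal separates the nine triangles of
   the torus from all other faces. *)
Require Import Defs.
From mathcomp Require Import all_boot all_order all_algebra all_fingroup.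
From mathcomp Require Import zify.
From Stdlib Require Import Classical.
Set Implicit Arguments.
Unset Strict Implicit.
Unset Printing Implicit Defensive.
Import GRing.Theory.

(** * Euler's formula and the lower bound *)

Section Porbits.
Variables (T : finType) (p : {perm T}).

Lemma mem_porbit_fconnect (x y : T) : (y \in porbit p x) = fconnect p x y.
Proof.
apply/porbitP/idP => [[i ->]|/iter_findex <-].
  by rewrite permX fconnect_iter.
by exists (findex p x y); rewrite permX.
Qed.

Lemma porbits_partition : partition (porbits p) [set: T].
Proof.
apply/and3P; split.
- rewrite eqEsubset subsetT; apply/subsetP => x _.
  by apply/bigcupP; exists (porbit p x); rewrite ?porbit_id // imset_f.
- apply/trivIsetP => _ _ /imsetP[x _ ->] /imsetP[y _ ->] neq_xy.
  rewrite -setI_eq0; apply: contraNT neq_xy => /set0Pn[z /setIP[zx zy]].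
  by rewrite -eq_porbit_mem in zx; rewrite -eq_porbit_mem in zy;
     rewrite -(eqP zx) (eqP zy).
- by apply/imsetP => -[x _ /setP/(_ x)]; rewrite inE porbit_id.
Qed.

Lemma sum_card_porbits : \sum_(A in porbits p) #|A| = #|T|.
Proof. by rewrite -(card_partition porbits_partition) cardsT. Qed.

Lemma card_porbits_ge k :
  (forall x, k <= #|porbit p x|) -> #|porbits p| * k <= #|T|.
Proof.
move=> ge_k; rewrite -sum_card_porbits -sum_nat_const.
by apply: leq_sum => _ /imsetP[x _ ->].
Qed.

Lemma card_porbits_uniform k :
  (forall x, #|porbit p x| = k) -> #|porbits p| * k = #|T|.
Proof.
move=> eq_k; rewrite -sum_card_porbits -sum_nat_const.
by apply: eq_bigr => _ /imsetP[x _ ->].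
Qed.

Lemma porbit_invol x : p (p x) = x -> porbit p x = [set x; p x].
Proof.
move=> pp; apply/setP=> y; rewrite mem_porbit_fconnect !inE.
by rewrite (@fconnect_cycle _ p [:: x; p x]) ?inE ?eqxx //= pp !eqxx.
Qed.

End Porbits.

Lemma card_vertex (M : cmap) : #|vertex M| = #|porbits (node M)|.
Proof. exact: card_sig. Qed.

Lemma card_edges (M : cmap) : #|porbits (edge M)| * 2 = #|M|.
Proof.
apply: card_porbits_uniform => d.
by rewrite porbit_invol ?edge_invol // cards2 eq_sym edge_free.
Qed.

Lemma origin_eqE (M : cmap) (d d' : M) :
  (origin d == origin d') = (d' \in porbit (node M) d).
Proof. by rewrite -val_eqE /= eq_sym eq_porbit_mem. Qed.

Lemma origin_surj (M : cmap) (x : vertex M) : exists d : M, origin d = x.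
Proof.
case: x => A PA; have /imsetP[d _ dA] := PA.
by exists d; apply: val_inj.
Qed.

Lemma origin_node (M : cmap) (d : M) : origin (node M d) = origin d.
Proof. by apply/eqP; rewrite eq_sym origin_eqE (mem_porbit _ 1). Qed.

(** If [x] had fewer than [k] neighbours, some vertex would lie outside them, and removing them
    would separate [x] from it. *)
Lemma kconnected_degree (k : nat) (G : sgraph) (x : G) :
  kconnected k G -> k <= #|[set y | sedge x y]|.
Proof.
move=> [ltkG conn]; rewrite leqNgt; apply/negP => ltk.
have xN : x \notin [set y | sedge x y] by rewrite inE sedge_irr.
have [y yN xy] : exists2 y, y \notin [set y | sedge x y] & y != x.
  have : 0 < #|~: (x |: [set y | sedge x y])|.
    by rewrite cardsCs setCK cardsU1 xN /= add1n subn_gt0 (leq_ltn_trans ltk).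
  by case/card_gt0P => y; rewrite !inE negb_or => /andP[yx yN]; exists y; rewrite ?inE.
have /connectP[[|z q] /= pq eq_y] := conn _ ltk x y xN yN.
  by rewrite eq_y eqxx in xy.
by move: pq; rewrite /remove_rel !inE => /andP[/and3P[_ /negPf->]].
Qed.

Lemma kconnected_node_orbit k (M : cmap) (d : M) :
  kconnected k (graph_of M) -> k <= #|porbit (node M) d|.
Proof.
move=> /(@kconnected_degree _ (graph_of M) (origin d)) /leq_trans; apply.
rewrite -(card_imset (mem (porbit (node M) d)) (@perm_inj _ (edge M))).
apply: leq_trans (leq_imset_card (@origin M) _).
apply/subset_leq_card/subsetP => y; rewrite inE /= => /andP[_].
case/existsP => d' /andP[/eqP eqd /eqP <-].
by rewrite !imset_f // -origin_eqE eqd.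
Qed.

(** A face of length one would be a loop. A face of length two would consist of two parallel edges,
    or of both darts of one edge, an end of which would then have degree one. *)
Lemma face_orbit_ge3 (M : cmap) (d : M) :
  simple_map M -> (forall d : M, 1 < #|porbit (node M) d|) ->
  2 < #|porbit (face M) d|.
Proof.
move=> [noloop nomulti] deg.
have fE x : face M x = node M (edge M x) by rewrite permM.
have ne1 : d != face M d.
  apply/eqP => eqd; apply: (noloop d); rewrite [in LHS]eqd fE.
  exact: origin_node.
have ne2 : d != face M (face M d).
  apply/eqP => eqd; set d' := face M d in ne1 eqd.
  have e1 : origin d' = origin (edge M d) by rewrite /d' fE origin_node.
  have e2 : origin d = origin (edge M d') by rewrite eqd fE origin_node.
  have : porbit (edge M) d = porbit (edge M) d'.
    by apply: nomulti; rewrite /ends -e1 -e2 setUC.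
  move/setP/(_ d'); rewrite porbit_id porbit_invol ?edge_invol // !inE.
  rewrite eq_sym (negPf ne1) /= => /eqP eqd'.
  have fix_e : node M (edge M d) = edge M d by rewrite -fE -/d' eqd'.
  have := deg (edge M d); rewrite porbit_invol ?fix_e //.
  by rewrite setUid cards1.
have ne3 : face M d != face M (face M d) by rewrite (inj_eq perm_inj).
have : [set d; face M d; face M (face M d)] \subset porbit (face M) d.
  apply/subsetP => x; rewrite !inE => /orP[/orP[]|] /eqP->.
  - exact: porbit_id.
  - exact: (mem_porbit (face M) 1).
  - by rewrite -permM (mem_porbit _ 2).
move/subset_leq_card; apply: leq_trans.
by rewrite setUC cardsU1 !inE cards2 ne1 ![face M (face M d) == _]eq_sym
  (negPf ne2) (negPf ne3).
Qed.

Lemma kconnected_giso k (G H : sgraph) :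
  giso G H -> kconnected k G -> kconnected k H.
Proof.
move=> [phi [psi phiK psiK] phiE] [ltk conn].
have cGH : #|G| = #|H| := bij_eq_card (Bijective phiK psiK).
split=> [|S ltS x y xS yS]; first by rewrite -cGH.
have ltS' : #|psi @: S| < k by rewrite (leq_ltn_trans (leq_imset_card _ _)).
have psiS z : (psi z \in psi @: S) = (z \in S).
  exact: mem_imset (can_inj psiK).
have := conn _ ltS' (psi x) (psi y); rewrite !psiS => /(_ xS yS).
case/connectP => q; elim: q x xS => [|z q IHq] x xS /=.
  by move=> _ /(can_inj psiK) <-; exact: connect0.
case/andP => /and3P[_ zS xz] pq ey.
rewrite -[z]phiK psiS in zS; rewrite -[z]phiK in pq ey.
apply: connect_trans (IHq (phi z) zS pq ey).
by apply: connect1; rewrite /remove_rel xS zS -[x]psiK phiE.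
Qed.

(** From k V <= 2 E and 3 F <= 2 E, Euler's formula gives 12 g >= 12 + (k - 6) V. As k >= 6,
    inserting V >= k + 1 yields the bound. *)
Lemma genus_ge k (G : sgraph) g : 6 <= k ->
  kconnected k G -> embeds G g -> (k - 2) * (k - 3) <= 12 * g.
Proof.
move=> k6 kG [M [h [[connM simM] genM hg iso]]].
have kM := kconnected_giso iso kG.
have degM d : k <= #|porbit (node M) d| := kconnected_node_orbit d kM.
have ltkV : k < #|vertex M| := proj1 kM.
have eE := card_edges M.
have leV : #|vertex M| * k <= #|M|.
  by rewrite card_vertex; exact: card_porbits_ge degM.
have leF : #|vertex (dual M)| * 3 <= #|M|.
  rewrite card_vertex; apply: card_porbits_ge => d.
  apply: (@face_orbit_ge3 M d simM) => d'.
  by apply: leq_trans (degM d'); apply: leq_trans k6.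
rewrite /has_genus in genM; nia.
Qed.

(** * Rotation systems of complete graphs *)

Definition swap_pair (T : Type) (p : T * T) : T * T := (p.2, p.1).

(* A rotation system of the complete graph on [V]: [r v] permutes cyclically the
   vertices other than [v], and the dart from [u] to [v] is the pair [(u, v)]. *)
Definition next_in_face (V : finType) (r : V -> V -> V) (p : V * V) : V * V :=
  (p.2, r p.2 p.1).

Lemma surjF_inj (T : finType) (f : T -> T) :
  (forall y, exists x, f x == y) -> injective f.
Proof.
move=> surj; have fK : cancel (fun y => xchoose (surj y)) f.
  by move=> y; apply/eqP; exact: (xchooseP (surj y)).
by have := canF_sym fK; exact: can_inj.
Qed.

Section CompleteMap.
(** [spec] lists the exceptional faces, each as its cycle of darts; by [tri], every other dart lies
    on a triangle. *)
Variables (V : finType) (r : V -> V -> V) (spec : seq (seq (V * V))).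
Local Notation phi := (next_in_face r).
Hypothesis V_gt3 : 3 < #|V|.
Hypothesis r_diag : forall v, r v v = v.
Hypothesis r_neq : forall u v, u != v -> r v u != v.
Hypothesis r_trans : forall v u w, u != v -> w != v -> fconnect (r v) u w.
Hypothesis spec_cycle : forall c, c \in spec -> fcycle phi c.
Hypothesis spec_uniq : uniq (flatten spec).
Hypothesis spec_off : forall p, p \in flatten spec -> p.1 != p.2.
Hypothesis tri : forall u v, u != v -> (u, v) \notin flatten spec ->
  r (r v u) v = u /\ r u (r v u) = v.

Lemma other_vertices (s : seq V) : size s <= 3 -> exists v, v \notin s.
Proof.
move=> les; case: (pickP [pred v | v \notin s]) => [v|none]; first by exists v.
have : #|V| <= size s.
  apply: leq_trans (card_size s); apply/subset_leq_card/subsetP => v _.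
  by have /negbFE := none v.
by rewrite leqNgt (leq_ltn_trans les).
Qed.

(** The rotation at [v] is one cycle through at least three vertices, so it has neither fixed points
    nor 2-cycles. *)
Lemma r_fix u v : r v u = u -> u = v.
Proof.
move=> ruu; apply/eqP/negPn/negP => neq.
have [w] := other_vertices (isT : size [:: u; v] <= 3).
rewrite !inE negb_or => /andP[wu wv].
have := r_trans neq wv; rewrite (@fconnect_cycle _ (r v) [:: u]) ?inE ?eqxx //.
  by rewrite (negPf wu).
by rewrite /= ruu eqxx.
Qed.

Lemma r_no2cycle u v : u != v -> r v (r v u) != u.
Proof.
move=> neq; apply/negP => /eqP r2.
have [w] := other_vertices (isT : size [:: u; r v u; v] <= 3).
rewrite !inE !negb_or => /and3P[wu wr wv].
have := r_trans neq wv.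
rewrite (@fconnect_cycle _ (r v) [:: u; r v u]) ?inE ?eqxx //.
  by rewrite (negPf wu) (negPf wr).
by rewrite /= r2 !eqxx.
Qed.

Lemma tri_cycle u v : u != v -> (u, v) \notin flatten spec ->
  fcycle phi [:: (u, v); (v, r v u); (r v u, u)].
Proof.
by move=> neq nspec; have [e1 e2] := tri neq nspec;
   rewrite /= /next_in_face /= e1 e2 !eqxx.
Qed.

(** Every dart has a predecessor, in its listed cycle or in its triangle, and the diagonal pairs,
    which are not darts, are fixed. So [phi] is a surjection of a finite set. *)
Lemma phi_inj : injective phi.
Proof.
apply: surjF_inj => -[u v]; have [->|neq] := eqVneq u v.
  by exists (v, v); rewrite /next_in_face /= r_diag.
have [/flattenP[c cs pc]|nspec] := boolP ((u, v) \in flatten spec).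
  by exists (prev c (u, v)); exact: (prev_cycle (spec_cycle cs) pc).
by exists (r v u, u); have /= := tri_cycle neq nspec; rewrite andbT => /and3P[].
Qed.

Definition rdart := {p : V * V | p.1 != p.2}.

Fact phi_off (d : rdart) : (phi (val d)).1 != (phi (val d)).2.
Proof. by rewrite eq_sym r_neq // (valP d). Qed.
Definition rface (d : rdart) : rdart := Sub (phi (val d)) (phi_off d).

Fact swap_off (d : rdart) : (swap_pair (val d)).1 != (swap_pair (val d)).2.
Proof. by rewrite eq_sym (valP d). Qed.
Definition redge (d : rdart) : rdart := Sub (swap_pair (val d)) (swap_off d).

Lemma rface_inj : injective rface.
Proof. by move=> d d' /(congr1 val) /phi_inj /val_inj. Qed.

Lemma redge_invol : involutive redge.
Proof. by move=> d; apply: val_inj; rewrite /= /swap_pair /=; case: (val d). Qed.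

Definition redge_perm := perm (inv_inj redge_invol).
(** Products of permutations act from left to right, so this choice makes [rface] the face
    permutation of the map. *)
Definition rnode_perm := (redge_perm * perm rface_inj)%g.

Fact redge_perm_invol : involutive redge_perm.
Proof. by move=> d; rewrite !permE redge_invol. Qed.

Fact redge_perm_free d : redge_perm d != d.
Proof.
rewrite permE -val_eqE /= /swap_pair; apply/eqP => e.
by have := valP d; move/(congr1 fst): e => /= ->; rewrite eqxx.
Qed.

Definition complete_map := CMap rnode_perm redge_perm_invol redge_perm_free.
Local Notation M := complete_map.

Lemma val_edge (d : M) : val (edge M d) = swap_pair (val d).
Proof. by rewrite /= permE. Qed.

Lemma val_face (d : M) : val (face M d) = phi (val d).
Proof. by rewrite /face permM /= permM redge_perm_invol permE. Qed.

Lemma val_node (d : M) : val (node M d) = ((val d).1, r (val d).1 (val d).2).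
Proof. by rewrite /= permM !permE. Qed.

Lemma origin_complete (d d' : M) : (origin d == origin d') = ((val d).1 == (val d').1).
Proof.
rewrite origin_eqE mem_porbit_fconnect; apply/idP/eqP.
  move/iter_findex <-; elim: (findex _ _ _) => // n IHn.
  by rewrite iterS val_node.
move=> e1; have e1' := esym e1.
have off (d1 : rdart) : (val d1).2 != (val d1).1 by rewrite eq_sym (valP d1).
have := r_trans (off d); move/(_ (val d').2); rewrite {1}e1 => /(_ (off d')).
move/iter_findex; set k := findex _ _ _ => ek.
suff -> : d' = iter k (node M) d by exact: fconnect_iter.
apply: val_inj; have -> : val d' = ((val d).1, iter k (r (val d).1) (val d).2).
  by rewrite ek e1; case: (val d').
elim: k {ek} => [|k IHk] /=; first by case: (val d).
by rewrite -[RHS]/(val (node M (iter k (node M) d))) val_node -IHk.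
Qed.

Lemma dart_of_proof (p : V * V) : p.1 != p.2 -> exists d : M, val d = p.
Proof. by move=> off; exists (Sub p off : rdart). Qed.

Lemma first_dart (v : V) : exists d : M, (val d).1 == v.
Proof.
have [w] := other_vertices (isT : size [:: v] <= 3).
by rewrite inE eq_sym => vw; have [d ed] := @dart_of_proof (v, w) vw; exists d; rewrite ed.
Qed.

Definition cvertex (v : V) : vertex M := origin (xchoose (first_dart v)).

Lemma origin_cvertex (d : M) : origin d = cvertex (val d).1.
Proof. by apply/eqP; rewrite origin_complete eq_sym (xchooseP (first_dart _)). Qed.

Lemma cvertex_inj : injective cvertex.
Proof.
move=> u v /eqP; rewrite origin_complete.
by rewrite (eqP (xchooseP (first_dart u))) (eqP (xchooseP (first_dart v))) => /eqP.
Qed.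

Lemma cvertex_surj x : exists v, x = cvertex v.
Proof. by have [d <-] := origin_surj x; exists (val d).1; rewrite origin_cvertex. Qed.

Lemma card_cvertex : #|vertex M| = #|V|.
Proof.
rewrite -(card_codom cvertex_inj); apply: eq_card => x.
by rewrite inE; have [v ->] := cvertex_surj x; rewrite codom_f.
Qed.

Lemma complete_adj (x y : vertex M) : vadj x y = (x != y).
Proof.
have [u ->] := cvertex_surj x; have [v ->] := cvertex_surj y.
rewrite /vadj (inj_eq cvertex_inj); case: (eqVneq u v) => //= neq.
have [d ed] := @dart_of_proof (u, v) neq.
by apply/existsP; exists d; rewrite !origin_cvertex val_edge ed /= !eqxx.
Qed.

Lemma complete_connected_off (S : {set graph_of M}) : connected_off S.
Proof.
move=> x y xS yS; have [->|neq] := eqVneq x y; first exact: connect0.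
by apply: connect1; rewrite /remove_rel xS yS; exact: (etrans (complete_adj x y) neq).
Qed.

Lemma complete_kconnected k : k < #|V| -> kconnected k (graph_of M).
Proof.
by move=> ltk; split=> [|S _]; [rewrite card_cvertex | exact: complete_connected_off].
Qed.

Lemma complete_simple : simple_map M.
Proof.
split=> [d /eqP|d d'].
  by rewrite origin_complete val_edge /=; apply/negP; exact: valP d.
rewrite /ends !origin_cvertex !val_edge /= => e.
have {}e v : (v \in [set (val d).1; (val d).2]) = (v \in [set (val d').1; (val d').2]).
  move/setP/(_ (cvertex v)): e; rewrite !inE !(inj_eq cvertex_inj) => ->; done.
apply/eqP; rewrite eq_sym eq_porbit_mem (porbit_invol (edge_invol d)). rewrite in_set2 -!(inj_eq val_inj) val_edge.
move: (valP d) (valP d') e; case: (val d) (val d') => [a b] [a' b'] /= ab ab' e.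
have := e a; have := e b; rewrite !inE !eqxx orbT /swap_pair /= !xpair_eqE.
move/esym/orP => [] /eqP <- /esym/orP[] /eqP ea; rewrite ea ?eqxx ?orbT // in ab *.
Qed.

Lemma complete_is_map : is_map M.
Proof.
split; last exact: complete_simple.
by split; [rewrite card_cvertex (leq_trans _ V_gt3) | exact: complete_connected_off].
Qed.

(** * Simplicity of the dual *)

Hypothesis spec_rev : forall c p, c \in spec -> p \in c -> swap_pair p \notin c.
Hypothesis spec_dual : forall c p q, c \in spec -> p \in c -> q \in c ->
  fconnect phi (swap_pair p) (swap_pair q) -> p = q.

Lemma dual_originE (d d' : M) :
  (@origin (dual M) d == @origin (dual M) d') = fconnect phi (val d) (val d').
Proof.
rewrite origin_eqE -[node _]/(face M) mem_porbit_fconnect.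
have it k : val (iter k (face M) d) = iter k phi (val d).
  by elim: k => // k IHk; rewrite !iterS val_face IHk.
apply/idP/idP => /iter_findex; first by move=> <-; rewrite it fconnect_iter.
by rewrite -it => /val_inj <-; exact: fconnect_iter.
Qed.

Lemma face_spec c p q : c \in spec -> p \in c -> fconnect phi p q = (q \in c).
Proof. by move=> cs pc; rewrite (fconnect_cycle (spec_cycle cs)). Qed.

Lemma face_tri u v q : u != v -> (u, v) \notin flatten spec ->
  fconnect phi (u, v) q = (q \in [:: (u, v); (v, r v u); (r v u, u)]).
Proof.
by move=> uv nspec; rewrite (fconnect_cycle (tri_cycle uv nspec)) ?inE ?eqxx.
Qed.

Lemma face_swap_neq p : p.1 != p.2 -> ~~ fconnect phi p (swap_pair p).
Proof.
case: p => u v /= uv.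
have [/flattenP[c cs pc]|nspec] := boolP ((u, v) \in flatten spec).
  by rewrite (face_spec _ cs pc) spec_rev.
rewrite face_tri // !inE /swap_pair /= !xpair_eqE [v == u]eq_sym (negPf uv) /= eqxx /=.
rewrite [v == r v u]eq_sym (negPf (r_neq uv)) /= orbF eq_sym.
by apply: contra uv => /eqP /r_fix ->.
Qed.

(** If either side of the edge is exceptional, [spec_dual] applies. Otherwise both sides are
    triangles, whose third vertices [r v u] and [r u v] differ because the rotation at [v] has no
    2-cycle, so they share only this edge. *)
Lemma face_swap_inj p q : p.1 != p.2 -> fconnect phi p q ->
  fconnect phi (swap_pair p) (swap_pair q) -> p = q.
Proof.
case: p q => u v [u' v'] /= uv.
have [/flattenP[c cs pc]|nspec] := boolP ((u, v) \in flatten spec).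
  by rewrite (face_spec _ cs pc) => qc; apply: spec_dual pc qc.
have [/flattenP[c cs pc]|nspec'] := boolP ((v, u) \in flatten spec).
  rewrite /swap_pair /= (face_spec _ cs pc) => pq qc.
  by have [-> ->] := spec_dual cs pc qc pq.
have vu : v != u by rewrite eq_sym.
have [ez1 ez2] := tri vu nspec'.
have nrv : r v u != r u v.
  by apply/eqP => e; have := r_no2cycle uv; rewrite e ez2 eqxx.
have w_u : r v u != u by apply: contraNneq uv => /r_fix ->.
have z_v : r u v != v by apply: contraNneq vu => /r_fix ->.
have w_v := r_neq uv; have z_u := r_neq vu.
rewrite !face_tri // !inE /swap_pair /= !xpair_eqE.
case/or3P => /andP[/eqP-> /eqP->] //.
- by rewrite (negPf w_v) (negPf w_u) (negPf nrv).
- by rewrite (negPf uv) (negPf nrv) [u == r u v]eq_sym (negPf z_u) andbF.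
Qed.

Lemma complete_dual_simple : simple_map (dual M).
Proof.
have noloop (d : M) : @origin (dual M) d != @origin (dual M) (edge M d).
  by rewrite dual_originE val_edge face_swap_neq // (valP (d : rdart)).
split=> [d /eqP|d d']; first by apply/negP; exact: noloop.
have inj (d1 d2 : M) : @origin (dual M) d1 = @origin (dual M) d2 ->
    @origin (dual M) (edge M d1) = @origin (dual M) (edge M d2) -> d1 = d2.
  move=> /eqP + /eqP; rewrite !dual_originE !val_edge => e1 e2.
  by apply: val_inj; apply: face_swap_inj e1 e2; exact: (valP (d1 : rdart)).
rewrite /ends => e; apply/eqP; rewrite eq_sym eq_porbit_mem.
rewrite (porbit_invol (edge_invol d)) in_set2.
move: (noloop d) (noloop d') => n n'.
have := set21 (@origin (dual M) d) (@origin (dual M) (edge M d)).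
have := set22 (@origin (dual M) d) (@origin (dual M) (edge M d)).
rewrite e !in_set2.
move=> /orP[] /eqP e2 /orP[] /eqP e1.
- by move: n; rewrite e1 -e2 eqxx.
- have -> : d = edge M d' by apply: inj => //; rewrite edge_invol.
  by rewrite edge_invol eqxx orbT.
- by rewrite (inj d d' e1 e2) eqxx.
- by move: n; rewrite e1 -e2 eqxx.
Qed.

Lemma card_rdart : #|M| = #|V| * #|V|.-1.
Proof.
rewrite (card_sig (fun p : V * V => p.1 != p.2)) -sum1_card.
rewrite -(pair_big_dep xpredT (fun u v => u != v) (fun _ _ => 1)) /=.
rewrite -sum_nat_const; apply: eq_bigr => u _.
by rewrite sum1_card -(cardC1 u); apply: eq_card => v; rewrite !inE eq_sym.
Qed.

(** * Counting the faces *)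

Hypothesis spec_nil : [::] \notin spec.

Lemma spec_disjoint c c' p : c \in spec -> c' \in spec -> p \in c -> p \in c' -> c = c'.
Proof.
elim: (spec) spec_uniq => //= a s IHs; rewrite cat_uniq => /and3P[_ /hasPn disj us].
have no b : b \in s -> p \in b -> p \in a -> False.
  move=> bs pb; have /disj /negP : p \in flatten s by apply/flattenP; exists b.
  exact.
rewrite !inE => /predU1P[->|cs] /predU1P[->|c's] // pc pc'.
- by case: (no c').
- by case: (no c).
- exact: IHs.
Qed.

Lemma uniq_spec : uniq spec.
Proof.
elim: (spec) spec_uniq spec_nil => //= a s IHs; rewrite cat_uniq inE negb_or.
move=> /and3P[_ /hasPn disj us] /andP[a0 s0]; rewrite IHs // andbT.
apply/negP; case: a a0 disj => // p a _ disj ins.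
have /disj /negP[] : p \in flatten s by apply/flattenP; exists (p :: a); rewrite ?inE ?eqxx.
by rewrite inE eqxx.
Qed.

Definition spec_orbit (c : seq (V * V)) : {set M} := [set d : rdart | val d \in c].

Lemma spec_dart c : c \in spec -> exists2 d : M, val d \in c & porbit (face M) d = spec_orbit c.
Proof.
move=> cs; have [p pc] : exists p, p \in c.
  by case: (c) cs => [|p a]; [rewrite (negPf spec_nil) | exists p; rewrite inE eqxx].
have [d ed] : exists d : M, val d = p.
  by apply: dart_of_proof; apply: spec_off; apply/flattenP; exists c.
exists d; rewrite ?ed //; apply/setP => d'.
have := dual_originE d d'; rewrite origin_eqE => ->.
by rewrite ed (face_spec _ cs pc) inE.
Qed.

Lemma uniq_spec_orbits : uniq [seq spec_orbit c | c <- spec].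
Proof.
rewrite map_inj_in_uniq ?uniq_spec // => c c' cs c's e.
have [d dc _] := spec_dart cs; apply: (spec_disjoint cs c's dc).
by have := in_set (fun d : rdart => val d \in c) d; rewrite -/(spec_orbit c) e inE dc.
Qed.

Lemma card_spec_orbit c : c \in spec -> #|spec_orbit c| = size c.
Proof.
move=> cs; have uc : uniq c.
  elim: (spec) spec_uniq cs => //= a s IHs; rewrite cat_uniq => /and3P[ua _ us].
  by rewrite inE => /predU1P[->|/(IHs us)].
have off : all (fun p : V * V => p.1 != p.2) c.
  by apply/allP => p pc; apply: spec_off; apply/flattenP; exists c.
rewrite -(card_uniqP uc) -(card_imset (mem (spec_orbit c)) val_inj).
apply: eq_card => p; apply/imsetP/idP => [[d]|pc]; first by rewrite inE => dc ->.
by have [d ed] := @dart_of_proof p (allP off p pc); exists d; rewrite ?inE ed.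
Qed.

Lemma tri_orbit (d : M) : val d \notin flatten spec -> #|porbit (face M) d| = 3.
Proof.
case ed: (val d) => [u v] nspec.
have uv : u != v by have := valP (d : rdart); rewrite /= ed.
have w_v := r_neq uv; have w_u : r v u != u by apply: contraNneq uv => /r_fix ->.
rewrite -(card_imset (mem (porbit (face M) d)) val_inj).
rewrite -[3]/(size [:: (u, v); (v, r v u); (r v u, u)]) -(card_uniqP _); last first.
  rewrite /= !inE !xpair_eqE (negPf w_u) [v == u]eq_sym (negPf uv).
  by rewrite !andbF.
apply: eq_card => q; rewrite -(face_tri q uv nspec) -ed.
apply/imsetP/idP => [[d' od' ->]|]; first by rewrite -dual_originE origin_eqE.
move=> /[dup] dq; rewrite ed face_tri // => qin.
have [|d' ed'] := @dart_of_proof q.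
  by move: qin; rewrite !inE => /or3P[] /eqP->; rewrite //= eq_sym.
by exists d'; rewrite ?ed' // -ed' -dual_originE origin_eqE in dq *.
Qed.

(** The darts are distributed among the faces: the listed faces take those in [flatten spec], every
    other face takes three. *)
Lemma card_faces :
  3 * #|vertex (dual M)| + size (flatten spec) = #|V| * #|V|.-1 + 3 * size spec.
Proof.
rewrite card_vertex -[node _]/(face M) -card_rdart -(sum_card_porbits (face M)).
pose Q := [seq spec_orbit c | c <- spec].
have QP A : A \in Q -> A \in porbits (face M).
  by case/mapP => c cs ->; have [d _ <-] := spec_dart cs; exact: imset_f.
have eQ : \sum_(A in porbits (face M) | A \in Q) #|A| = size (flatten spec).
  rewrite (eq_bigl (mem Q)) => [|A]; last first.
    by apply/andP/idP => [[]|AQ] //; rewrite QP.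
  rewrite -big_uniq ?uniq_spec_orbits // big_map size_flatten sumnE big_map.
  by rewrite !big_seq; apply: eq_bigr => c; exact: card_spec_orbit.
have cQ : \sum_(A in porbits (face M) | A \in Q) 1 = size spec.
  rewrite (eq_bigl (mem Q)) => [|A]; last first.
    by apply/andP/idP => [[]|AQ] //; rewrite QP.
  by rewrite sum1_card (card_uniqP uniq_spec_orbits) size_map.
have nQ : \sum_(A in porbits (face M) | A \notin Q) #|A| =
          3 * \sum_(A in porbits (face M) | A \notin Q) 1.
  rewrite big_distrr /=; apply: eq_bigr => A /andP[/imsetP[d _ ->] nA].
  rewrite muln1; apply: tri_orbit; apply: contra nA => /flattenP[c cs dc].
  apply/mapP; exists c => //; apply/setP => d'.
  have := dual_originE d d'; rewrite origin_eqE => ->.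
  by rewrite (face_spec _ cs dc) inE.
rewrite (bigID (mem Q)) /= eQ nQ -sum1_card [X in 3 * X](bigID (mem Q)) /= cQ.
lia.
Qed.

(** * The 1-cut of the dual *)

Variables (c0 : seq (V * V)) (B : pred (V * V)).
Hypothesis c0_spec : c0 \in spec.
Hypothesis B_face : forall p, p.1 != p.2 -> p \notin c0 -> B (phi p) = B p.
Hypothesis B_swap : forall p, B (swap_pair p) = B p.
Hypothesis B_in : exists p, [/\ p.1 != p.2, p \notin c0 & B p].
Hypothesis B_out : exists p, [/\ p.1 != p.2, p \notin c0 & ~~ B p].

Lemma B_orbit p q : p.1 != p.2 -> p \notin c0 -> fconnect phi p q -> B q = B p.
Proof.
move=> off pc0 /iter_findex <-; set k := findex _ _ _.
suff [_ _ ->] : [/\ (iter k phi p).1 != (iter k phi p).2, iter k phi p \notin c0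
                  & B (iter k phi p) = B p] by [].
elim: k => // k [off' nc0 <-]; rewrite iterS B_face //; split=> //.
  by rewrite eq_sym r_neq.
apply: contra nc0 => c0p; rewrite -(face_spec _ c0_spec c0p).
by rewrite (fconnect_sym phi_inj) fconnect1.
Qed.

(** [B] is constant on each face other than [c0] and does not change across an edge, so it is
    constant along dual walks that avoid [c0]; yet it takes both values. *)
Lemma complete_one_cut : exists f : graph_of (dual M), one_cut f.
Proof.
have [d0 d0c _] := spec_dart c0_spec; exists (@origin (dual M) d0) => conn.
have notf (d : M) : (@origin (dual M) d \notin [set @origin (dual M) d0]) = (val d \notin c0).
  by rewrite inE eq_sym dual_originE (face_spec _ c0_spec d0c).
have off (d : M) : (val d).1 != (val d).2 := valP (d : rdart).
have [p1 [o1 n1 Bp1]] := B_in; have [p2 [o2 n2 Bp2]] := B_out.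
have [d1 e1] := dart_of_proof o1; have [d2 e2] := dart_of_proof o2.
have := conn (@origin (dual M) d1) (@origin (dual M) d2).
rewrite !notf e1 e2 => /(_ n1 n2) /connectP[q pq lq].
have : B (val d2) = B (val d1); last by rewrite e1 e2 Bp1 (negPf Bp2).
rewrite -e1 in n1; elim: q (d1) n1 pq lq {e1} => [|x q IHq] d nd /=.
  by move=> _ /eqP; rewrite eq_sym dual_originE => /(B_orbit (off d) nd).
case/andP => /and3P[_ xf /andP[_ /existsP[d' /andP[/eqP ed' /eqP ex]]]] pq lq.
move: (xf) pq lq; rewrite -ex notf => nd' pq lq; rewrite (IHq _ nd' pq lq).
rewrite val_edge B_swap; apply: B_orbit (off d) nd _.
by rewrite -dual_originE ed'.
Qed.

End CompleteMap.

(** * Surgery on a triangular embedding of K_n - K_7 *)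

(* Row [i] lists the letters in the rotation at the letter [i].  The chords are 01, 12,
   34, 45; the other 17 edges of K_7 form the map on the torus, found by a computer
   search among the eight-vertex triangulations of the torus in which one vertex is
   joined to all letters. *)
Definition arcs : seq (seq nat) :=
  [:: [:: 5; 3; 2; 4; 6; 1]; [:: 0; 3; 5; 6; 4; 2]; [:: 1; 4; 0; 3; 6; 5];
      [:: 6; 2; 0; 5; 1; 4]; [:: 3; 1; 6; 0; 2; 5]; [:: 4; 2; 6; 1; 3; 0];
      [:: 0; 4; 1; 5; 2; 3]].
Definition arc (i : nat) : seq nat := nth [::] arcs i.

(** The default 7 is the code of the vertex [o], which follows the last letter of an arc. *)
Definition after (i k : nat) : nat := nth 7 (arc i) (index k (arc i)).+1.

(* Codes of the vertices involved in the surgery: the letters are 0, ..., 6, the vertex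
   0 of the current graph is 7, its neighbour following the letter [i] is [i + 8], and
   15 stands for any other vertex. *)
Definition code_rot (v u : nat) : nat :=
  if v < 7 then
    if u < 7 then if u == v then 15 else after v u
    else if u == v + 8 then head 15 (arc v) else 15
  else if v == 7 then if u < 7 then 8 + u.+1 %% 7 else 15
  else if u == 7 then v - 8 else 15.

(** The merged face of length 21 runs through [X i], [O], [Y (i + 1)], [X (i + 1)], [O] and so on.
    The four chords cut off the quadrilaterals of [code_faces] and leave a face of length 13.
    Joining it to the heptagon 3, 6, 0, 5, 2, 4, 1 gives these 13 + 7 darts. *)
Definition big_face : seq (nat * nat) :=
  [:: (7, 11); (11, 3); (3, 6); (6, 7); (7, 8); (8, 0); (0, 5); (5, 7);
      (7, 14); (14, 6); (6, 0); (0, 1); (1, 3); (3, 4); (4, 1); (1, 2);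
      (2, 4); (4, 5); (5, 2); (2, 7)].
Definition code_faces : seq (seq (nat * nat)) :=
  [:: big_face; [:: (7, 10); (10, 2); (2, 1); (1, 7)];
      [:: (7, 12); (12, 4); (4, 3); (3, 7)];
      [:: (7, 13); (13, 5); (5, 4); (4, 7)];
      [:: (7, 9); (9, 1); (1, 0); (0, 7)]].

Definition chord (i k : nat) : bool :=
  (minn i k, maxn i k) \in [:: (0, 1); (1, 2); (3, 4); (4, 5)].
(** The darts of the 17 edges on the torus; off [big_face] they are the sides of the nine
    triangles. *)
Definition code_inner (p : nat * nat) : bool :=
  [&& p.1 < 7, p.2 < 7 & ~~ chord p.1 p.2].

(** The bounds by 15 restrict a step to vertices that have a code of their own. *)
Definition code_step (p q : nat * nat) : bool :=
  [&& p.1 < 15, p.2 < 15, code_rot p.2 p.1 < 15 & q == (p.2, code_rot p.2 p.1)].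

(** * Finite checks on the coded faces *)

Definition letters := iota 0 7.

Lemma code_faces_cycle : all (path.cycle code_step) code_faces.
Proof. by vm_compute. Qed.
Lemma code_faces_uniq : uniq (flatten code_faces).
Proof. by vm_compute. Qed.
Lemma code_faces_valid :
  all (fun p => [&& p.1 < 15, p.2 < 15 & p.1 != p.2]) (flatten code_faces).
Proof. by vm_compute. Qed.
Lemma code_faces_shape :
  all (fun p => [&& (p.1 < 7) ==> (p.2 <= 7), (p.1 == 7) ==> (7 < p.2)
                  & (7 < p.1) ==> (p.2 == p.1 - 8)]) (flatten code_faces).
Proof. by vm_compute. Qed.
Lemma code_faces_swap :
  all (fun c => all (fun p => swap_pair p \notin c) c) code_faces.
Proof. by vm_compute. Qed.
Lemma code_faces_corner : all (fun i =>
    [&& (i, 7) \in flatten code_faces, (7, i + 8) \in flatten code_faces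
      & (i + 8, i) \in flatten code_faces]) letters.
Proof. by vm_compute. Qed.
(** These are the nine triangles of the torus. *)
Lemma code_tri : all (fun k => all (fun i =>
    (k != i) ==> ((k, i) \notin flatten code_faces) ==>
    let w := code_rot i k in
    [&& w < 7, code_rot w i == k & code_rot k w == i]) letters) letters.
Proof. by vm_compute. Qed.
(** When the letter [i + 1] directly follows [Y i] in the row of [o], the reverses of these two
    darts lie on one old triangle. The dual would have a double edge if the darts themselves also
    shared a face. *)
Lemma code_faces_next_corner : all (fun c => all (fun i =>
    ~~ (((7, i + 8) \in c) && ((i.+1 %% 7, 7) \in c))) letters) code_faces.
Proof. by vm_compute. Qed.

(** The face through [p]: an exceptional one if there is one, otherwise a triangle traced in three
    steps. *)
Definition code_orbit (p : nat * nat) : seq (nat * nat) :=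
  head (traject (fun p => (p.2, code_rot p.2 p.1)) p 3)
    [seq c <- code_faces | p \in c].
Lemma code_orbit_cycle : all (fun p =>
    (p.1 < 7) ==> (p.2 < 7) ==>
    let c := code_orbit (swap_pair p) in
    [&& path.cycle code_step c, swap_pair p \in c
      & all (fun q => (q.1 < 15) && (q.2 < 15)) c])
  (flatten code_faces).
Proof. by vm_compute. Qed.
Lemma code_orbit_dual : all (fun c => all (fun p =>
    (p.1 < 7) ==> (p.2 < 7) ==>
    all (fun q => (swap_pair q \in code_orbit (swap_pair p)) ==> (p == q)) c) c)
  code_faces.
Proof. by vm_compute. Qed.

(** [i + 8] is the only vertex outside the letters that is followed by a letter in the new row of
    the letter [i]. *)
Lemma code_inner_step : all (fun i => all (fun k =>
    (k != i) ==> ((k, i) \notin big_face) ==> (code_rot i k < 15) &&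
    (code_inner (i, code_rot i k) == code_inner (k, i))) (i + 8 :: letters)) letters.
Proof. by vm_compute. Qed.
Lemma arc_perm : all (fun i => perm_eq (i :: arc i) letters) letters.
Proof. by vm_compute. Qed.
Lemma after_nth : all (fun i => all (fun p =>
    after i (nth 7 (arc i) p) == nth 7 (arc i) p.+1) (iota 0 6)) letters.
Proof. by vm_compute. Qed.

(** * The modified rotation system *)

Section Surgery.
Variables (U : finType) (o : U).
Local Notation V := (U + 'I_7)%type.
Variables (t : V -> V -> V) (y : 'I_7 -> U).
Local Notation O := (inl o : V).
Local Notation Y i := (inl (y i) : V).
Local Notation X i := (inr i : V).
Hypothesis t_inj : forall v, injective (t v).
Hypothesis t_diag : forall u : U, t (inl u) (inl u) = inl u.
Hypothesis t_trans : forall (u : U) (v w : V), v != inl u -> w != inl u ->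
  fconnect (t (inl u)) v w.
Hypothesis t_letter : forall (i : 'I_7) (j : U), exists w : U, t (X i) (inl j) = inl w.
Hypothesis t_letters : forall i j : 'I_7, t (X i) (X j) = X j.
Hypothesis t_letter_trans : forall (i : 'I_7) (j k : U),
  fconnect (t (X i)) (inl j) (inl k).
Definition adjacent (u v : V) : bool :=
  (u != v) && (if u is inr _ then if v is inr _ then false else true else true).
Hypothesis t_tri : forall u v, adjacent u v ->
  t (t v u) v = u /\ t u (t v u) = v.
Hypothesis t_next : forall i, t O (X i) = Y i.
(** The letters occur in the row of [o] in the cyclic order 0, ..., 6, with no other letter between
    [Y i] and the next one. *)
Hypothesis t_segment : forall i, exists s : seq U,
  fpath (t O) (Y i) (rcons (map inl s) (X (ordS i))).

Definition code (k : nat) : V :=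
  if k < 7 then X (inord k) else if k == 7 then O else Y (inord (k - 8)).
Definition code_pair (p : nat * nat) : V * V := (code p.1, code p.2).

(* The row of [O] is rearranged so that the seven triangles on the corners
   [(X i, O, Y i)] merge into one face; all edges between the letters are drawn at
   the corner of [X i] between [Y i] and [O]. *)
Definition rot (v u : V) : V :=
  match v, u with
  | inl a, inr i => if a == o then Y (ordS i) else t v u
  | inl _, inl _ => t v u
  | inr i, inl b => if b == y i then code (head 15 (arc i)) else t v u
  | inr i, inr k => if i == k then u else code (after i k)
  end.

Local Notation phi := (next_in_face rot).
Definition faces := map (map code_pair) code_faces.

Lemma code_letter (i : 'I_7) : code i = X i.
Proof. by rewrite /code ltn_ord inord_val. Qed.
Lemma code_o : code 7 = O. Proof. by []. Qed.
Lemma code_y (i : 'I_7) : code (i + 8) = Y i.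
Proof. by rewrite /code addnK inord_val; case: i => -[|[|[|[|[|[|[]]]]]]]. Qed.

Lemma all_letters (P : nat -> bool) (i : 'I_7) : all P letters -> P i.
Proof. by move/allP; apply; rewrite mem_iota ltn_ord. Qed.

Lemma codeP k : k < 15 ->
  [\/ exists2 i : 'I_7, k = i & code k = X i, k = 7 /\ code k = O
    | exists2 i : 'I_7, k = i + 8 & code k = Y i].
Proof.
move=> ltk; case: (ltngtP k 7) => [k7|k7|->]; last by constructor 2.
  by constructor 1; exists (Ordinal k7); rewrite // -code_letter.
have ltk8 : k - 8 < 7 by lia.
have ek : k = Ordinal ltk8 + 8 by rewrite /=; lia.
by constructor 3; exists (Ordinal ltk8) => //; rewrite {1}ek code_y.
Qed.

Lemma t_neq (u : U) v : v != inl u -> t (inl u) v != inl u.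
Proof. by apply: contraNneq => e; apply/eqP/(t_inj (v := inl u)); rewrite t_diag. Qed.

Lemma t_yo i : t (Y i) O = X i.
Proof. by have [+ _] := t_tri (isT : adjacent (X i) O); rewrite t_next. Qed.

Lemma t_xy i : t (X i) (Y i) = O.
Proof. by have [_ +] := t_tri (isT : adjacent (X i) O); rewrite t_next. Qed.

Lemma y_neq_o i : y i != o.
Proof. by have := @t_neq o (X i) isT; rewrite t_next. Qed.

Lemma y_inj : injective y.
Proof. by move=> i j e; have := t_yo i; rewrite e t_yo => -[]. Qed.

Lemma t_inl (u : U) (i : 'I_7) : exists w, t (inl u) (X i) = inl w.
Proof.
have [+ _] := t_tri (isT : adjacent (X i) (inl u)).
by case: (t (inl u) _) => [w _|k]; [exists w | have [w ->] := t_letter k u].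
Qed.

Lemma code_inj k l : k < 15 -> l < 15 -> code k = code l -> k = l.
Proof.
move=> /codeP[[i -> ->]|[-> ->]|[i -> ->]] /codeP[[j -> ->]|[-> ->]|[j -> ->]] //.
- by case=> ->.
- by case=> /esym/eqP; rewrite (negPf (y_neq_o j)).
- by case=> /eqP; rewrite (negPf (y_neq_o i)).
- by case=> /y_inj ->.
Qed.

Lemma code_pair_inj p q : (p.1 < 15) && (p.2 < 15) -> (q.1 < 15) && (q.2 < 15) ->
  code_pair p = code_pair q -> p = q.
Proof.
case: p q => a b [c d] /= /andP[la lb] /andP[lc ld] [].
by move=> /(code_inj la lc) -> /(code_inj lb ld) ->.
Qed.

Lemma rot_code v u : v < 15 -> u < 15 -> code_rot v u < 15 ->
  rot (code v) (code u) = code (code_rot v u).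
Proof.
have h1 k : (k + 8 < 7) = false by lia.
have h2 k : (k + 8 == 7) = false by lia.
have h3 k : (7 == k + 8) = false by lia.
move=> /codeP[[i -> ->]|[-> ->]|[i -> ->]] /codeP[[j -> ->]|[-> ->]|[j -> ->]];
  rewrite /code_rot ?ltn_ord ?h1 ?h2 ?h3 //=.
- by rewrite [i == j]eq_sym -val_eqE /=; case: ifP.
- by rewrite eqn_add2r val_eqE (inj_eq y_inj); case: ifP.
- by rewrite eqxx addnC -(code_y (ordS j)).
- by rewrite ltn_eqF.
- by rewrite addnK code_letter t_yo.
Qed.

Lemma faces_cycle c : c \in faces -> fcycle phi c.
Proof.
case/mapP => c' /(allP code_faces_cycle) + ->.
apply: homo_cycle => p q /and4P[p1 p2 r12 /eqP ->].
by rewrite /= /next_in_face /code_pair /= rot_code.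
Qed.

Lemma mem_flatten_faces (p : V * V) :
  reflect (exists2 q, q \in flatten code_faces & p = code_pair q)
          (p \in flatten faces).
Proof. by rewrite -map_flatten; apply: (iffP mapP) => -[q]; exists q. Qed.

Lemma code_lt15 p : p \in flatten code_faces -> (p.1 < 15) && (p.2 < 15).
Proof. by case/(allP code_faces_valid)/and3P => -> ->. Qed.

Lemma faces_uniq : uniq (flatten faces).
Proof.
rewrite -map_flatten map_inj_in_uniq ?code_faces_uniq // => p q ps qs.
by apply: code_pair_inj; apply: code_lt15.
Qed.

Lemma faces_off p : p \in flatten faces -> p.1 != p.2.
Proof.
case/mem_flatten_faces => q /(allP code_faces_valid) /and3P[l1 l2 q12] -> /=.
by apply: contra q12 => /eqP /(code_inj l1 l2) ->.
Qed.

Lemma mem_faces (p : nat * nat) : (p.1 < 15) && (p.2 < 15) ->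
  (code_pair p \in flatten faces) = (p \in flatten code_faces).
Proof.
move=> pv; apply/mem_flatten_faces/idP => [[q qs e]|ps]; last by exists p.
by rewrite (code_pair_inj pv (code_lt15 qs) e).
Qed.

Lemma corner_faces i :
  [/\ (X i, O) \in flatten faces, (O, Y i) \in flatten faces
    & (Y i, X i) \in flatten faces].
Proof.
have /and3P[c1 c2 c3] := all_letters i code_faces_corner.
split; apply/mem_flatten_faces.
- by exists (i : nat, 7); rewrite // /code_pair /= code_letter.
- by exists (7, i + 8); rewrite // /code_pair /= code_y.
- by exists (i + 8, i : nat); rewrite // /code_pair /= code_y code_letter.
Qed.

Lemma rot_t u v : adjacent u v -> (u, v) \notin flatten faces -> rot v u = t v u.
Proof.
case: v u => [a|i] [b|j]; rewrite /adjacent ?andbF //= => _ nf; case: eqP => // e; case/negP: nf; rewrite e.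
  by have [] := corner_faces j.
by have [] := corner_faces i.
Qed.

Lemma adjacent_tri u v : adjacent u v ->
  adjacent v (t v u) /\ adjacent (t v u) u.
Proof.
move=> uv; have [e1 e2] := t_tri uv; move: uv e1 e2.
case: v u => [a|i] [b|j]; rewrite /adjacent ?andbF ?andbT //.
- move=> ba _ e2; have ca := t_neq ba.
  split; first by rewrite eq_sym ca.
  have cb : t (inl a) (inl b) != inl b.
    apply: contraNneq ba => ecb; move: e2; rewrite ecb t_diag => ->; exact: eqxx.
  by rewrite cb; case: (t (inl a) (inl b)).
- by move=> _ _ _; have [c ec] := t_inl a j; have := @t_neq a (X j) isT;
     rewrite ec eq_sym => ->.
- move=> _ _ e2; have [c ec] := t_letter i b; rewrite ec in e2 *; split=> //.
  by rewrite andbT; apply/eqP => -[ecb]; rewrite ecb t_diag in e2.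
Qed.

(** All exceptional darts other than the corner darts join two letters. *)
Lemma special_corner p : p \in flatten faces -> adjacent p.1 p.2 ->
  exists i, [\/ p = (X i, O), p = (O, Y i) | p = (Y i, X i)].
Proof.
case/mem_flatten_faces => -[a b] ps -> /=.
have /and3P[/= la lb _] := allP code_faces_valid _ ps.
have /and3P[/=] := allP code_faces_shape _ ps; rewrite /code_pair /=.
case/codeP: la ps => [[i -> ->]|[-> ->]|[i -> ->]] _;
  case/codeP: lb => [[j -> ->]|[-> ->]|[j -> ->]]; rewrite /adjacent ?eqxx ?andbF //=.
- by exists i; constructor 1.
- by rewrite ltn_ord => /= ?; lia.
- by have := ltn_ord j; lia.
- by exists j; constructor 2.
- rewrite addnK; have -> : (7 < i + 8) by lia.
  by move=> _ _ /= /eqP /val_inj ->; exists i; constructor 3.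
- by rewrite addnK; have := ltn_ord i; lia.
- by rewrite addnK; have := ltn_ord i; lia.
Qed.

Lemma corner_next u v : adjacent u v -> (u, v) \in flatten faces ->
  (v, t v u) \in flatten faces.
Proof.
move=> uv /special_corner /(_ uv) [i]; have [c1 c2 c3] := corner_faces i.
by case=> -[-> ->]; rewrite ?t_next ?t_yo ?t_xy.
Qed.

(** Between two letters the table decides. Any other dart off the exceptional faces keeps its old
    triangle: by [corner_next], if one dart of that triangle were exceptional, all three would
    be. *)
Lemma faces_tri u v : u != v -> (u, v) \notin flatten faces ->
  rot (rot v u) v = u /\ rot u (rot v u) = v.
Proof.
move=> uv nf; have [uv_adj|] := boolP (adjacent u v); last first.
  rewrite /adjacent uv; case: u v uv nf => [//|k] [//|i] ki nf _.
  have ki' : (k : nat) != i by [].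
  have kv : (k < 15) && (i < 15) by rewrite !(leq_trans (ltn_ord _)).
  have := all_letters i (all_letters (P := fun k => all _ letters) k code_tri).
  have ep : code_pair (k : nat, i : nat) = (X k, X i) by rewrite /code_pair /= !code_letter.
  rewrite ki' -(mem_faces (p := (k : nat, i : nat)) kv) ep nf !implyTb.
  move/and3P; set w := code_rot i k => -[w7 /eqP ew1 /eqP ew2].
  have lt15 x : x < 7 -> x < 15 by move/leq_trans; apply.
  have e1 : rot (X i) (X k) = code w.
    by rewrite -[X i]code_letter -[X k]code_letter rot_code ?lt15.
  rewrite e1; split.
    by rewrite -[X i]code_letter rot_code ?lt15 ?ew1 ?code_letter.
  by rewrite -[X k]code_letter rot_code ?lt15 ?ew2 ?code_letter.
have [e1 e2] := t_tri uv_adj; rewrite (rot_t uv_adj nf); set w := t v u in e1 e2 *.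
have [vw wu] := adjacent_tri uv_adj; rewrite -/w in vw wu.
have nwu : (w, u) \notin flatten faces.
  by apply: contra nf => /(corner_next wu); rewrite e2.
have nvw : (v, w) \notin flatten faces.
  by apply: contra nwu => /(corner_next vw); rewrite e1.
by rewrite !rot_t.
Qed.

(** * Each new row is a single cycle *)

Lemma rot_diag v : rot v v = v.
Proof. by case: v => [a|i] /=; rewrite ?t_diag ?eqxx. Qed.

Lemma size_arc (i : 'I_7) : size (arc i) = 6.
Proof. by have /perm_size [] := all_letters i arc_perm. Qed.

Lemma mem_arc (i k : 'I_7) : ((k : nat) \in arc i) = (k != i).
Proof.
have := perm_mem (all_letters i arc_perm) k.
have /perm_uniq := all_letters i arc_perm; rewrite /= => /andP[iN _].
rewrite inE mem_iota ltn_ord; case: (eqVneq k i) => [-> _|ki]; first exact: negPf.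
by rewrite (negPf (ki : (k : nat) != i)).
Qed.

Lemma nth_arc (i : 'I_7) p : p < 6 -> exists2 k : 'I_7, k != i & nth 7 (arc i) p = k.
Proof.
move=> ltp; have inp : nth 7 (arc i) p \in arc i by rewrite mem_nth ?size_arc.
have lt7 : nth 7 (arc i) p < 7.
  have := perm_mem (all_letters i arc_perm) (nth 7 (arc i) p).
  by rewrite inE inp orbT mem_iota.
by exists (Ordinal lt7); rewrite // -mem_arc.
Qed.

(** The new row of a letter leads from [Y i] through the whole arc; index 6 lies just past the arc
    and gives the default 7, that is [O]. *)
Lemma rot_arc (i : 'I_7) p : p <= 6 ->
  rot (X i) (if p is p'.+1 then code (nth 7 (arc i) p') else Y i)
    = code (nth 7 (arc i) p).
Proof.
case: p => [|p] ltp; first by rewrite /= eqxx; case: (arc i) (size_arc i).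
have [k ki ek] := nth_arc i ltp; rewrite ek code_letter /= eq_sym (negPf ki) -ek.
have /allP/(_ p) := all_letters i after_nth.
by rewrite mem_iota => /(_ ltp)/eqP->.
Qed.

Lemma code_arc_end (i : 'I_7) : code (nth 7 (arc i) 6) = O.
Proof. by rewrite nth_default ?size_arc. Qed.

Lemma letter_on_arc (i k : 'I_7) : k != i ->
  exists2 p, p < 6 & code (nth 7 (arc i) p) = X k.
Proof.
rewrite -mem_arc => ka; exists (index (k : nat) (arc i)).
  by move: (ka); rewrite -index_mem size_arc.
by rewrite nth_index // code_letter.
Qed.

Lemma rot_surj v w : exists u, rot v u == w.
Proof.
have t_surj v' w' : exists u', t v' u' = w'.
  by exists (invF (@t_inj v') w'); rewrite f_invF.
case: v => [a|i].
  have [->|ao] := eqVneq a o; last first.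
    have [u <-] := t_surj (inl a) w; exists u.
    by case: u => [b|j] //=; rewrite (negPf ao).
  have [[b|j] <-] := t_surj O w; first by exists (inl b).
  (* In the rearranged row the segment starting at [Y j] is entered from the letter preceding
     [j]. *)
  by exists (X (ord_pred j)); rewrite /= eqxx t_next ord_predK.
case: w => [b|k]; last first.
  have [->|ki] := eqVneq k i; first by exists (X i); rewrite /= eqxx.
  have [p ltp <-] := letter_on_arc ki.
  by eexists; rewrite -(@rot_arc i p) // ltnW.
have [->|bo] := eqVneq b o.
  by eexists; rewrite -[inl o](code_arc_end i) -(@rot_arc i 6).
have [[c|j] ec] := t_surj (X i) (inl b).
  exists (inl c); rewrite /= ec; have [ecy|//] := eqVneq c (y i).
  by move: ec bo; rewrite ecy t_xy => -[->]; rewrite eqxx.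
by rewrite t_letters in ec.
Qed.

Lemma rot_inj v : injective (rot v).
Proof. by apply: surjF_inj => w; exact: rot_surj. Qed.

Lemma rot_neq u v : u != v -> rot v u != v.
Proof. by apply: contraNneq => e; apply/eqP/(@rot_inj v); rewrite rot_diag. Qed.

Lemma rot_segment i : fconnect (rot O) (Y i) (X (ordS i)).
Proof.
have [s ps] := t_segment i; apply/connectP; exists (rcons (map inl s) (X (ordS i))).
  rewrite rcons_path in ps; rewrite rcons_path; case/andP: ps => ps /eqP ls; apply/andP; split.
    elim: s (y i) {ls} ps => // b s IHs a /andP[/eqP eb ps].
    by apply/andP; split; [apply/eqP | exact: IHs].
  by rewrite /= -ls; elim/last_ind: (s) => //= s' b _; rewrite map_rcons last_rcons.
by rewrite last_rcons.
Qed.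

Lemma rot_trans v u w : u != v -> w != v -> fconnect (rot v) u w.
Proof.
have sym := fconnect_sym (@rot_inj v).
case: v sym => [a|i] sym.
  have [ea|ao] := eqVneq a o; last first.
    move=> ua wa; rewrite (eq_fconnect (f' := t (inl a))) ?t_trans // => -[b|j] //=.
    by rewrite (negPf ao).
  rewrite ea in sym *.
  (* The segment of [Y i] ends at the letter [i + 1], from which the new row jumps to
     [Y (i + 2)]. *)
  have yS i : fconnect (rot O) (Y i) (Y (ordS (ordS i))).
    apply: connect_trans (rot_segment i) _.
    by have := fconnect1 (rot O) (X (ordS i)); rewrite /= eqxx.
  have y0 i : fconnect (rot O) (Y ord0) (Y i).
    have it n : fconnect (rot O) (Y ord0) (Y (iter n (fun j => ordS (ordS j)) ord0)).
      elim: n => [|n IHn]; first exact: connect0.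
      exact: connect_trans IHn (yS _).
    (* As 4 is the inverse of 2 modulo 7, [4 i] jumps by two lead from [Y 0] to [Y i]: the seven
       segments form one cycle. *)
    have := it (i * 4); congr (fconnect _ _ (inl (y _))).
    by case: i => -[|[|[|[|[|[|[|//]]]]]]] lti; apply: val_inj.
  (* The old row reaches every vertex from [Y 0]. The new row agrees with it except after a letter
     [j], where the old one goes to [Y j], already known to be reached. *)
  have base b : b != O -> fconnect (rot O) (Y ord0) b.
    move=> bO; have := @t_trans o (Y ord0) b.
    rewrite (negPf _ : Y ord0 == O = false) => [/(_ isT bO)|]; last first.
      by have := y_neq_o ord0; apply: contra => /eqP [->].
    move/iter_findex <-; elim: (findex _ _ _) => [|n IHn]; first exact: connect0.
    rewrite iterS; case: (iter _ _ _) IHn => [c|j] IHn.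
      exact: connect_trans IHn (fconnect1 (rot O) (inl c)).
    by rewrite t_next.
  by move=> uO wO; apply: connect_trans (base w wO); rewrite sym base.
have arc_conn p : p <= 6 -> fconnect (rot (X i)) (Y i) (code (nth 7 (arc i) p)).
  elim: p => [|p IHp] ltp; first by rewrite -rot_arc // fconnect1.
  rewrite -(rot_arc i ltp); apply: connect_trans (IHp (ltnW ltp)) _.
  exact: fconnect1.
have yO : fconnect (rot (X i)) (Y i) O by rewrite -(code_arc_end i) arc_conn.
have base b : b != X i -> fconnect (rot (X i)) O b.
  case: b => [b|k] bX; last first.
    have [|p ltp <-] := @letter_on_arc i k; first by apply: contra bX => /eqP->.
    by apply: connect_trans (arc_conn p (ltnW ltp)); rewrite sym.
  have := t_letter_trans i o b => /iter_findex; set n := findex _ _ _ => en.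
  suff : exists2 c, iter n (t (X i)) O = inl c & fconnect (rot (X i)) O (inl c).
    by rewrite en => -[c [->]].
  elim: n {en} => [|n [c ec IHn]]; first by exists o; rewrite ?connect0.
  have [d ed] := t_letter i c; exists d; first by rewrite iterS ec ed.
  (* At [Y i] the old row returns to [O], which is the starting point; elsewhere the two rows
     agree. *)
  have [ecy|cy] := eqVneq c (y i).
    by move: ed; rewrite ecy t_xy => -[<-]; exact: connect0.
  apply: connect_trans IHn _; rewrite -ed.
  by have := fconnect1 (rot (X i)) (inl c); rewrite /= (negPf cy).
by move=> uX wX; apply: connect_trans (base w wX); rewrite sym base.
Qed.

(** * Faces across the exceptional faces *)

Lemma rot_o (i : 'I_7) : exists2 a : U, rot (X i) O = inl a & t (X i) O = inl a.
Proof.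
have [a ea] := t_letter i o; exists a => //=.
by rewrite eq_sym (negPf (y_neq_o i)).
Qed.

Lemma t_oy i j : t O (Y j) = X i -> i = ordS j.
Proof.
have [s] := t_segment j; case: s => [|b s] /=.
  by rewrite andbT => /eqP-> [->].
by case/andP => /eqP->.
Qed.

Lemma ordS_neq (i : 'I_7) : i <> ordS i.
Proof. by case: i => -[|[|[|[|[|[|[|//]]]]]]] ? /(congr1 val). Qed.

Lemma t_oy_neq i : t O (Y i) <> X i.
Proof. by move/t_oy/ordS_neq. Qed.

Lemma t_yx_neq i : t (Y i) (X i) <> O.
Proof.
move=> e; have [+ _] := t_tri (isT : adjacent (X i) (Y i)).
by rewrite e; exact: t_oy_neq.
Qed.

Lemma code_shape p : p \in flatten code_faces ->
  [\/ exists i k : 'I_7, p = (i : nat, k : nat), exists i : 'I_7, p = (i : nat, 7),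
      exists i : 'I_7, p = (7, i + 8) | exists i : 'I_7, p = (i + 8, i : nat)].
Proof.
case: p => a b ps; have /= /andP[la lb] := code_lt15 ps.
have /and3P[/= s1 s2 s3] := allP code_faces_shape _ ps.
case: (ltngtP a 7) s1 s2 s3 => [a7|a7|->] /= s1 s2 s3.
- move: s1; rewrite leq_eqVlt => /predU1P[->|b7].
    by constructor 2; exists (Ordinal a7).
  by constructor 1; exists (Ordinal a7), (Ordinal b7).
- have b7 : b < 7 by lia.
  constructor 4; exists (Ordinal b7); congr pair => /=; lia.
- have b7 : b - 8 < 7 by lia.
  constructor 3; exists (Ordinal b7); congr pair => /=; lia.
Qed.

Lemma swap_code p : swap_pair (code_pair p) = code_pair (swap_pair p).
Proof. by []. Qed.

Lemma not_special u v : adjacent u v ->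
  (forall i, [/\ (u, v) <> (X i, O), (u, v) <> (O, Y i) & (u, v) <> (Y i, X i)]) ->
  (u, v) \notin flatten faces.
Proof.
move=> uv ne; apply/negP => /special_corner/(_ uv)[i e].
by have [n1 n2 n3] := ne i; case: e.
Qed.

Lemma orbit_tri u v q : u != v -> (u, v) \notin flatten faces ->
  fconnect phi (u, v) q -> q \in [:: (u, v); (v, rot v u); (rot v u, u)].
Proof. by move=> uv nf; rewrite (face_tri faces_tri _ uv nf). Qed.

(** The face across the corner dart [(X i, O)] is an old triangle. A second exceptional edge on it
    can only be the one from [O] to [Y j], and then the segment of [Y j] consists of that vertex
    alone. *)
Lemma orbit_ox (i : 'I_7) q : q \in flatten code_faces ->
  fconnect phi (O, X i) (code_pair (swap_pair q)) ->
  q = (i : nat, 7) \/ exists2 j : 'I_7, q = (7, j + 8) & i = ordS j.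
Proof.
move=> qs /orbit_tri-/(_ isT).
have -> : (O, X i) \notin flatten faces.
  by apply: not_special => // j; split=> // -[ej]; move/eqP: ej (y_neq_o j); rewrite eq_sym => ->.
have [a -> ea] := rot_o i; have [_ e2] := t_tri (isT : adjacent O (X i)).
rewrite ea in e2 => /(_ isT).
case/code_shape: qs => [[j [k ->]]|[j ->]|[j ->]|[j ->]];
  rewrite /code_pair /= ?code_letter ?code_y ?code_o !inE !xpair_eqE /= ?andbF //=.
- by rewrite orbF => /andP[_ /eqP[->]]; left.
- move=> /andP[/eqP[ej] _]; right; exists j => //.
  by apply: t_oy; rewrite ej e2.
- rewrite orbF => /andP[/eqP[eji] /eqP[ea']].
  by case: (@t_oy_neq i); rewrite -eji ea' eji e2.
Qed.

Lemma yo_neq j : (Y j == O) = false.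
Proof. by apply/eqP => -[ej]; have := y_neq_o j; rewrite ej eqxx. Qed.

Lemma orbit_yo (i : 'I_7) q : q \in flatten code_faces ->
  fconnect phi (Y i, O) (code_pair (swap_pair q)) ->
  q = (7, i + 8) \/ q = (ordS i : nat, 7).
Proof.
move=> qs /orbit_tri-/(_ (negbT (yo_neq i))).
have -> : (Y i, O) \notin flatten faces.
  apply: not_special => [|j]; first by rewrite /adjacent yo_neq.
  by split=> // -[_ /esym/eqP]; rewrite (negPf (y_neq_o j)).
have ez : rot O (Y i) = t O (Y i) by [].
rewrite ez => /(_ isT).
case/code_shape: qs => [[j [k ->]]|[j ->]|[j ->]|[j ->]];
  rewrite /code_pair /= ?code_letter ?code_y ?code_o !inE !xpair_eqE /= ?andbF ?eqxx //=.
- by rewrite orbF eq_sym => /eqP /t_oy ->; right.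
- by rewrite yo_neq [O == Y i]eq_sym yo_neq andbT andbF !orbF => /eqP[/y_inj ->]; left.
- by rewrite eq_sym => /andP[/eqP e /eqP[/y_inj eij]]; case: (@t_oy_neq i); rewrite e eij.
Qed.

Lemma orbit_xy (i : 'I_7) q : q \in flatten code_faces ->
  fconnect phi (X i, Y i) (code_pair (swap_pair q)) -> q = (i + 8, i : nat).
Proof.
move=> qs /orbit_tri-/(_ isT).
have -> : (X i, Y i) \notin flatten faces.
  by apply: not_special => // j; split=> // -[_ /eqP]; rewrite (negPf (y_neq_o i)).
have ew : rot (Y i) (X i) = t (Y i) (X i) by rewrite /= (negPf (y_neq_o i)).
have wo : (t (Y i) (X i) == O) = false by apply/eqP/t_yx_neq.
have [w ew'] := t_inl (y i) i.
rewrite ew => /(_ isT).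
case/code_shape: qs => [[j [k ->]]|[j ->]|[j ->]|[j ->]];
  rewrite /code_pair /= ?code_letter ?code_y ?code_o !inE !xpair_eqE /= ?andbF //=.
- by rewrite ew'.
- by rewrite [O == Y i]eq_sym yo_neq [O == _]eq_sym wo.
- by rewrite [O == _]eq_sym wo andbF.
- by rewrite orbF => /andP[/eqP[->]].
Qed.

Lemma faces_rev c p : c \in faces -> p \in c -> swap_pair p \notin c.
Proof.
case/mapP => c' cs -> /mapP[q qc ->]; rewrite swap_code.
have qs : q \in flatten code_faces by apply/flattenP; exists c'.
have := allP (allP code_faces_swap c' cs) q qc; apply: contra => /mapP[q' q'c].
have q's : q' \in flatten code_faces by apply/flattenP; exists c'.
move/code_pair_inj => -> //; last exact: code_lt15.
by rewrite /= andbC code_lt15.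
Qed.

(** Across a dart between two letters lies a face known from the table, which settles the claim.
    Across a corner dart lies an old triangle, and the only possible second exceptional edge on it
    is excluded by [code_faces_next_corner]. *)
Lemma faces_dual c p q : c \in faces -> p \in c -> q \in c ->
  fconnect phi (swap_pair p) (swap_pair q) -> p = q.
Proof.
case/mapP => c' cs -> /mapP[p' pc ->] /mapP[q' qc ->]; rewrite !swap_code => pq.
congr code_pair.
have ps : p' \in flatten code_faces by apply/flattenP; exists c'.
have qs : q' \in flatten code_faces by apply/flattenP; exists c'.
have corner j := all_letters j (allP code_faces_next_corner c' cs).
case/code_shape: (ps) => [[i [k ep]]|[i ep]|[i ep]|[i ep]]; rewrite ep in pq pc *.
- have /implyP := allP code_orbit_cycle p' ps.
  rewrite ep ltn_ord => /(_ isT) /implyP/(_ (ltn_ord k)) /and3P[cyc pin valid].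
  have := allP (allP code_orbit_dual c' cs) _ pc; rewrite !ltn_ord /=.
  move/allP/(_ q' qc)/implyP => dual; apply/eqP/dual; move: pq.
  have cyc' : fcycle phi (map code_pair (code_orbit (swap_pair (i : nat, k : nat)))).
    apply: homo_cycle cyc => a b /and4P[a1 a2 r12 /eqP ->].
    by rewrite /= /next_in_face /code_pair /= rot_code.
  rewrite (fconnect_cycle cyc' (map_f code_pair pin)) => /mapP[a ain].
  move/code_pair_inj => -> //; last exact: (allP valid).
  by rewrite /= andbC code_lt15.
- move: pq; rewrite /code_pair /= code_letter => /(orbit_ox qs)[//|[j ej eij]].
  by have := corner j; rewrite -ej qc -[_ %% 7]/(ordS j : nat) -eij pc.
- move: pq; rewrite /code_pair /= code_y => /(orbit_yo qs)[//|ej].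
  by have := corner i; rewrite pc -[_ %% 7]/(ordS i : nat) -ej qc.
- by move: pq; rewrite /code_pair /= code_y code_letter => /(orbit_xy qs).
Qed.

(** * The cut face and the resulting map *)

Definition inner (p : V * V) : bool :=
  if p is (inr i, inr k) then ~~ chord i k else false.

Lemma inner_code p : (p.1 < 15) && (p.2 < 15) -> inner (code_pair p) = code_inner p.
Proof.
case: p => a b /= /andP[la lb].
rewrite -[LHS]/(inner (code a, code b)) /code_inner /=.
have h k : (k + 8 < 7) = false by lia.
case/codeP: la => [[i -> ->]|[-> ->]|[i -> ->]];
  case/codeP: lb => [[j -> e]|[-> e]|[j -> e]];
  by rewrite ?e /= ?ltn_ord ?h ?andbF.
Qed.

Lemma inner_swap p : inner (swap_pair p) = inner p.
Proof. by case: p => [[a|i] [b|k]]; rewrite //= /chord minnC maxnC. Qed.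

Lemma mem_big_face q : (q.1 < 15) && (q.2 < 15) ->
  (code_pair q \in map code_pair big_face) = (q \in big_face).
Proof.
move=> qv; apply/mapP/idP => [[q' q'b]|qb]; last by exists q.
move/code_pair_inj => -> //; apply: code_lt15; apply/flattenP.
by exists big_face; first exact: mem_head.
Qed.

(** Only steps at a letter that come from a letter or from [Y i] can involve an inner dart, and
    those are in the table. All other steps have no inner dart on either side. *)
Lemma inner_step p : p.1 != p.2 -> p \notin map code_pair big_face ->
  inner (phi p) = inner p.
Proof.
have step (i : 'I_7) k : k < 15 -> k \in i + 8 :: letters -> k != i ->
    (code k, X i) \notin map code_pair big_face ->
    inner (phi (code k, X i)) = inner (code k, X i).
  move=> k15 kin ki nb; have i15 : i < 15 := leq_trans (ltn_ord i) (isT : 7 <= 15).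
  have kv : ((k, i : nat).1 < 15) && ((k, i : nat).2 < 15) by rewrite k15.
  have ep : code_pair (k, i : nat) = (code k, X i) by rewrite /code_pair code_letter.
  have := allP (all_letters i code_inner_step) k kin.
  rewrite ki -mem_big_face // ep nb !implyTb => /andP[r15 /eqP e].
  rewrite -ep inner_code // -e -inner_code; last by rewrite i15.
  by rewrite /next_in_face /code_pair rot_code.
case: p => [[a|k] [b|i]] neq nb.
- by [].
- have [ea|ay] := eqVneq a (y i).
    rewrite ea -code_y in nb *; apply: step nb; rewrite ?mem_head //.
      by have := ltn_ord i; lia.
    by apply/eqP; lia.
  rewrite /next_in_face /= (negPf ay); by have [c ->] := t_letter i a.
- by [].
- rewrite -(code_letter k) in nb *; apply: step nb => //.
    exact: leq_trans (ltn_ord k) _.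
  by rewrite inE mem_iota ltn_ord orbT.
Qed.

Lemma surgery_map : exists M : cmap,
  [/\ is_map M, forall k, k < #|U| + 7 -> kconnected k (graph_of M),
      simple_map (dual M), exists f : graph_of (dual M), one_cut f
    & [/\ #|vertex M| = #|U| + 7, #|M| = (#|U| + 7) * (#|U| + 6)
        & 3 * #|vertex (dual M)| + 21 = #|M|]].
Proof.
have cV : #|{: V}| = #|U| + 7 by rewrite card_sum card_ord.
have V_gt3 : 3 < #|{: V}| by rewrite cV ltn_addl.
exists (complete_map rot_diag rot_neq faces_cycle faces_tri).
have faces_nil : [::] \notin faces by [].
split.
- by apply: complete_is_map => //; exact: rot_trans.
- by move=> k; rewrite -cV => ltk; apply: complete_kconnected => //; exact: rot_trans.
- by apply: complete_dual_simple => //; [exact: rot_trans | exact: faces_rev | exact: faces_dual].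
- have bcode q : [&& (q.1 < 15) && (q.2 < 15), q.1 != q.2 & q \notin big_face] ->
      (code_pair q).1 != (code_pair q).2 /\ code_pair q \notin map code_pair big_face.
    case/and3P => qv q12 qb; rewrite mem_big_face //; split=> //.
    by case/andP: qv => q1 q2; apply: contra q12 => /eqP /(code_inj q1 q2) ->.
  apply: (@complete_one_cut _ _ _ _ _ _ faces_off _ faces_nil (map code_pair big_face) inner).
  + exact: mem_head.
  + exact: inner_step.
  + exact: inner_swap.
  (* This dart is the reverse of a side of the heptagon and lies on a triangle of the torus. *)
  + exists (code_pair (6, 3)); have [] := bcode (6, 3) isT; split=> //.
    by rewrite inner_code.
  (* This dart belongs to a chord and lies on a quadrilateral. *)
  + exists (code_pair (2, 1)); have [] := bcode (2, 1) isT; split=> //.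
    by rewrite inner_code.
have eM : #|complete_map rot_diag rot_neq faces_cycle faces_tri| = (#|U| + 7) * (#|U| + 6).
  by rewrite card_rdart cV addnS.
split=> //; first by rewrite card_cvertex //; exact: rot_trans.
have := card_faces V_gt3 rot_diag rot_neq rot_trans faces_cycle faces_uniq faces_off
  faces_tri faces_nil.
have -> : #|{: V}| * #|{: V}|.-1 = (#|U| + 7) * (#|U| + 6) by rewrite cV addnS.
rewrite -eM; move: #|complete_map _ _ _ _| => D; set F := #|vertex _|.
(* The five exceptional faces have 20 + 4 x 4 = 36 darts, so 3 F + 36 = D + 15. *)
have -> : size (flatten faces) = 36 by rewrite -map_flatten size_map.
by rewrite size_map /=; lia.
Qed.

End Surgery.

(** * Triangular embeddings from a cyclic log *)

Section CurrentGraph.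
Variables (p : nat) (even_p : ~~ odd p).
Local Notation G := ('I_p.+2).
Local Notation V := (G + 'I_7)%type.
Variables (twin : 'I_7 -> 'I_7) (twinK : involutive twin).
Variables (L : seq V) (uniqL : uniq L) (memL : forall v, (v \in L) = (v != inl 0%R)).

Definition twist (a : G) (x : 'I_7) : 'I_7 := if odd a then twin x else x.

(* Two consecutive entries [u], [v] of row 0 span a triangle with the vertex 0; this is
   the condition that the rows of [u] and [v] contain the same triangle. *)
Definition triangle_rule (u v : V) : bool :=
  match u, v with
  | inl a, inl b => next L (inl (b - a)%R) == inl (- a)%R
  | inl a, inr x => next L (inr (twist a x)) == inl (- a)%R
  | inr x, inl b => next L (inl (- b)%R) == inr (twist b x)
  | inr _, inr _ => false
  end.
Hypothesis rule : path.cycle triangle_rule L.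

Definition shift (a : G) (v : V) : V :=
  match v with inl b => inl (a + b)%R | inr x => inr (twist a x) end.

(* Row [a] is row [0] translated by [a], with the letters of the degree-two
   vortices exchanged when [a] is odd; the rows of the letters follow. *)
Definition base_rot (v u : V) : V :=
  match v, u with
  | inl a, _ => shift a (next L (shift (- a)%R u))
  | inr x, inl j => shift j (prev L (inr (twist j x)))
  | inr _, inr _ => u
  end.

Lemma odd_ordD (a b : G) : odd (a + b)%R = odd a (+) odd b.
Proof. by rewrite /= odd_mod ?oddD //= negbK (negbTE even_p). Qed.

Lemma odd_ordN (a : G) : odd (- a)%R = odd a.
Proof. by have := odd_ordD (- a)%R a; rewrite addNr; case: (odd a); case: (odd (- a)%R). Qed.

Lemma twistD a b x : twist (a + b)%R x = twist a (twist b x).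
Proof. by rewrite /twist odd_ordD; case: (odd a); case: (odd b); rewrite //= twinK. Qed.

Lemma twistN a x : twist (- a)%R x = twist a x.
Proof. by rewrite /twist odd_ordN. Qed.

Lemma twistK a : involutive (twist a).
Proof. by move=> x; rewrite -{1}twistN -twistD addNr. Qed.

Lemma shiftD a b v : shift (a + b)%R v = shift a (shift b v).
Proof. by case: v => [c|x] /=; rewrite ?addrA ?twistD. Qed.

Lemma shift0 v : shift 0%R v = v.
Proof. by case: v => [c|x] /=; rewrite ?add0r. Qed.

Lemma shiftK a : cancel (shift a) (shift (- a)%R).
Proof. by move=> v; rewrite -shiftD addNr shift0. Qed.

Lemma shiftNK a : cancel (shift (- a)%R) (shift a).
Proof. by move=> v; rewrite -shiftD addrN shift0. Qed.

(** By this symmetry the triangles at a group vertex need to be checked only at the vertex 0. *)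
Lemma shift_rot a v u : base_rot (shift a v) (shift a u) = shift a (base_rot v u).
Proof.
case: v => [b|x] /=.
  have -> : shift (- (a + b))%R (shift a u) = shift (- b)%R u.
    by rewrite -shiftD opprD addrC addrA addrN add0r.
  exact: shiftD.
case: u => [j|y] //=; rewrite shiftD; congr (shift a (shift j (prev L (inr _)))).
by rewrite addrC twistD twistK.
Qed.

Lemma next_rule v : v != inl 0%R -> triangle_rule v (next L v).
Proof. by rewrite -memL; exact: next_cycle. Qed.

Lemma prev_rule v : v != inl 0%R -> triangle_rule (prev L v) v.
Proof. by rewrite -memL; exact: prev_cycle. Qed.

Lemma next0 : next L (inl 0%R) = inl 0%R.
Proof. by rewrite next_nth memL eqxx. Qed.

Lemma inl_G_inj (a b : G) : inl a = inl b :> V -> a = b.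
Proof. by case. Qed.

Lemma base_rot_diag a : base_rot (inl a) (inl a) = inl a.
Proof. by rewrite /= addNr next0 /= addr0. Qed.

Lemma base_rot_letter x j : exists w, base_rot (inr x) (inl j) = inl w.
Proof.
have := @prev_rule (inr (twist j x)) isT; rewrite /=.
by case: (prev L _) => [b _|//]; exists (j + b)%R.
Qed.

Lemma base_rot_tri0 u : u != inl 0%R ->
  base_rot (base_rot (inl 0%R) u) (inl 0%R) = u /\
  base_rot u (base_rot (inl 0%R) u) = inl 0%R.
Proof.
move=> u0; have := next_rule u0.
have -> : base_rot (inl 0%R) u = next L u by rewrite /= oppr0 !shift0.
case eu: u u0 => [a|x] u0; case en: (next L _) => [b|y] //= /eqP e1.
- rewrite !addr0 [(- a + b)%R]addrC e1 /= addrN; split=> //.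
  have ba0 : inl (b - a)%R != inl 0%R :> V.
    apply: contraTneq u0 => ba; move: e1; rewrite ba next0 => /inl_G_inj a0.
    by rewrite negbK -[a]opprK -a0 oppr0.
  (* The rule at [a] has described the row of [a]. The rule at [b - a], whose successor is [- a],
     describes the row of [b]. *)
  have := next_rule ba0; rewrite e1 /= (_ : (- a - (b - a) = - b)%R) => [/eqP -> /=|].
    by rewrite opprB addrCA addrN addr0.
  by rewrite opprB addrA addNr add0r.
- rewrite twistN e1 /= addrN; split=> //.
  by rewrite shift0 -[twist 0%R y]/y -en (prev_next uniqL).
- rewrite addr0 e1 /= twistK; split=> //.
  by rewrite -e1 (prev_next uniqL) /= addrN.
Qed.

(** A triangle at a group vertex is translated to the vertex 0. A triangle given at a letter is read
    instead at its group vertex [j], in whose row [w] precedes the letter. *)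
Lemma base_rot_tri u v : adjacent u v ->
  base_rot (base_rot v u) v = u /\ base_rot u (base_rot v u) = v.
Proof.
have tri_inl a w : w != inl a -> base_rot (base_rot (inl a) w) (inl a) = w /\
    base_rot w (base_rot (inl a) w) = inl a.
  move=> wa; have w0 : shift (- a)%R w != inl 0%R.
    by apply: contra wa => /eqP e; rewrite -[w](shiftNK a) e /= addr0.
  have ea : inl a = shift a (inl 0%R) :> V by rewrite /= addr0.
  have [e1 e2] := base_rot_tri0 w0.
  by rewrite ea -[w](shiftNK a) !shift_rot e1 e2.
case: v => [a|x] /andP[uv]; first by move=> _; exact: tri_inl.
case: u uv => [j|y] //= _ _.
have [w ew] := base_rot_letter x j; rewrite /= in ew; rewrite ew.
have e : base_rot (inl j) (inl w) = inr x.
  by rewrite -ew /= shiftK (next_prev uniqL) /= twistK.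
have wj : inl w != inl j :> V.
  by apply: contra_eq_neq e => ->; rewrite base_rot_diag.
by have := tri_inl j (inl w) wj; rewrite e => -[e1 e2].
Qed.

Lemma next_inj : injective (next L).
Proof. exact: can_inj (prev_next uniqL). Qed.

Lemma base_rot_inj v : injective (base_rot v).
Proof.
case: v => [a|x] u w.
  by move=> /= /(can_inj (shiftK a))/next_inj/(can_inj (shiftNK a)).
have jx j : adjacent (inl j : V) (inr x) by [].
case: u w => [j|y] [k|z] e //.
- have [<- _] := base_rot_tri (jx j); have [<- _] := base_rot_tri (jx k).
  by rewrite e.
- by have [w] := base_rot_letter x j; rewrite e.
- by have [w] := base_rot_letter x k; rewrite -e.
Qed.

Lemma next_trans u v : u != inl 0%R -> v != inl 0%R -> fconnect (next L) u v.
Proof.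
by rewrite -!memL => uL vL; rewrite (fconnect_cycle (cycle_next uniqL)).
Qed.

Lemma base_rot_trans (a : G) (v w : V) : v != inl a -> w != inl a ->
  fconnect (base_rot (inl a)) v w.
Proof.
have shift_neq u : u != inl a -> shift (- a)%R u != inl 0%R.
  by apply: contra => /eqP e; rewrite -[u](shiftNK a) e /= addr0.
move=> /shift_neq va /shift_neq wa; have := next_trans va wa.
move/iter_findex; set n := findex _ _ _ => en.
suff <- : iter n (base_rot (inl a)) v = w by exact: fconnect_iter.
apply: (can_inj (shiftNK a)); rewrite -en.
by elim: n {en} => //= n <-; rewrite shiftK.
Qed.

End CurrentGraph.

(** * The log over Z_(12s+2) *)

Section PathBlocks.
Variables (T : Type) (e : rel T) (link : nat -> T) (block : nat -> seq T).

(** Consecutive blocks meet at the entries [link i], so being a path can be tested block by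
    block. *)
Lemma path_blocks N : (forall i, last (link i) (block i) = link i.+1) ->
  path e (link 0) (flatten (map block (iota 0 N)))
    = all (fun i => path e (link i) (block i)) (iota 0 N)
  /\ last (link 0) (flatten (map block (iota 0 N))) = link N.
Proof.
move=> lastE; elim: N => // N [IH1 IH2].
rewrite -addn1 iotaD map_cat flatten_cat all_cat cat_path last_cat /= add0n cats0.
by rewrite IH1 IH2 lastE andbT addn1.
Qed.

Lemma path_blocks_rev N : (forall i, last (link i.+1) (block i) = link i) ->
  path e (link N) (flatten (map block (rev (iota 0 N))))
    = all (fun i => path e (link i.+1) (block i)) (iota 0 N)
  /\ last (link N) (flatten (map block (rev (iota 0 N)))) = link 0.
Proof.
move=> lastE; elim: N => // N [IH1 IH2].
rewrite -addn1 iotaD rev_cat all_cat /= add0n addn1 cat_path last_cat lastE.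
by rewrite IH1 IH2 andbT andbC.
Qed.

End PathBlocks.

Definition int_mod (s : nat) (x : int) : 'I_(12 * s).+2 := (x%:~R)%R.

(* The degree-two vortices carry the letters 1, 3 and 4, 6. *)
Definition twin7 (x : 'I_7) : 'I_7 := inord (nth 0 [:: 0; 3; 2; 1; 6; 5; 4] x).

Section Log.
Local Open Scope ring_scope.
Variable s : nat.
Hypothesis s_ge2 : (2 <= s)%N.
Local Notation S := (s%:Z).
Local Notation V := ('I_(12 * s).+2 + 'I_7)%type.
Local Notation z x := (inl (int_mod s x) : V).
Local Notation X k := (inr (inord k) : V).

(** The [2 s - 4] rungs are taken in pairs; for [s = 2] there are none. *)
Let N := (s - 2)%N.
(* The log passes four times through the ladder; each block is the passage along two
   consecutive rungs, whose currents are [2 i + 1] and [2 i + 2]. *)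
Definition down_block (i : nat) : seq int :=
  [:: - (2 * i%:Z + 2); - (3 * S + i%:Z + 1); - (2 * i%:Z + 1); 5 * S - i%:Z].
Definition up_block (i : nat) : seq int :=
  [:: 2 * i%:Z + 2; 5 * S + i%:Z + 1; 2 * i%:Z + 1; - (3 * S - i%:Z)].
Definition top_block (i : nat) : seq int := [:: 3 * S + i%:Z + 1; 3 * S - i.+1%:Z].
Definition bottom_block (i : nat) : seq int :=
  [:: - (5 * S + i%:Z + 1); - (5 * S - i.+1%:Z)].

(** The log is cut at the letters: [seg0], ..., [seg6] follow the letters 0, ..., 6, and the run
    after the last letter wraps around from [seg6] to [segA]. *)
Definition segA : seq int := [:: 2 * S; - (4 * S); 2 * S + 1].
Definition seg0 : seq int :=
  [:: - (2 * S + 1); 6 * S + 1; 4 * S; 6 * S; 4 * S + 2]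
  ++ flatten (map down_block (rev (iota 0 N))) ++ 3 * S
  :: flatten (map top_block (iota 0 N)) ++ [:: - (2 * S - 3)].
Definition seg1 : seq int := [:: - (2 * S - 1)].
Definition seg2 : seq int := [:: 2 * S - 1].
Definition seg3 : seq int := [:: 2 * S - 3; 4 * S - 1].
Definition seg4 : seq int := [:: 4 * S + 1; 6 * S - 1].
Definition seg5 : seq int :=
  [:: - (6 * S - 1); - (2 * S - 2); - (6 * S); - (2 * S); - (5 * S)]
  ++ flatten (map bottom_block (iota 0 N)) ++ [:: 2 * S - 2; - (4 * S + 1)].
Definition seg6 : seq int :=
  [:: - (4 * S - 1); - (2 * S + 2)] ++ flatten (map up_block (rev (iota 0 N))).

Definition ints : seq int := segA ++ seg0 ++ seg1 ++ seg2 ++ seg3 ++ seg4 ++ seg5 ++ seg6.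

Definition residues (q : seq int) : seq V := map (fun x => z x) q.
Definition log : seq V :=
  residues segA ++ X 0 :: residues seg0 ++ X 1 :: residues seg1 ++ X 2 :: residues seg2 ++ X 3 :: residues seg3
  ++ X 4 :: residues seg4 ++ X 5 :: residues seg5 ++ X 6 :: residues seg6.

Lemma size_log : size log = (12 * s + 8)%N.
Proof.
have sz (f : nat -> seq int) n : (forall i, size (f i) = n) -> forall r, size (flatten (map f r)) = (n * size r)%N.
  by move=> fn; elim=> [|i r IHr] /=; rewrite ?muln0 // size_cat fn IHr mulnS.
rewrite /log /residues /seg0 /seg5 /seg6; do 9! rewrite /= ?size_cat ?size_map.
rewrite (sz down_block 4) // (sz top_block 2) // (sz bottom_block 2) // (sz up_block 4) //.
by rewrite !size_rev !size_iota /N; lia.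
Qed.

Lemma mem_block (f : nat -> seq int) (r : seq nat) i x :
  r =i iota 0 N -> (i < N)%N -> x \in f i -> x \in flatten (map f r).
Proof.
move=> er iN xi; apply/flattenP; exists (f i) => //.
by rewrite map_f // er mem_iota.
Qed.

(** The interval represents each residue modulo 12 s + 2 once. The blocks fill ten subintervals,
    [d1] to [b2], and the other integers are listed one by one. *)
Lemma mem_ints (x : int) : x != 0 -> - (6 * S) <= x -> x <= 6 * S + 1 -> x \in ints.
Proof.
move=> x0 lex ltx; rewrite /ints /segA /seg0 /seg1 /seg2 /seg3 /seg4 /seg5 /seg6.
rewrite !mem_cat !in_cons !mem_cat !in_cons !in_nil.
set mD := x \in flatten _; set mT := x \in flatten _.
set mB := x \in flatten _; set mU := x \in flatten _.
have NS : N%:Z = S - 2 by rewrite /N; lia.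
have inD i y : x = y -> (i < N)%N -> y \in down_block i -> mD.
  by move=> <- iN; apply: mem_block iN => k; rewrite mem_rev.
have inT i y : x = y -> (i < N)%N -> y \in top_block i -> mT.
  by move=> <- iN; exact: mem_block iN.
have inB i y : x = y -> (i < N)%N -> y \in bottom_block i -> mB.
  by move=> <- iN; exact: mem_block iN.
have inU i y : x = y -> (i < N)%N -> y \in up_block i -> mU.
  by move=> <- iN; apply: mem_block iN => k; rewrite mem_rev.
have d1 : - (2 * S - 4) <= x <= -1 -> mD.
  move=> rx; pose i := (`|x|%N.-1./2)%N; have iN : (i < N)%N by lia.
  have [e|e] : x = - (2 * i%:Z + 2) \/ x = - (2 * i%:Z + 1) by lia.
    by apply: inD e iN _; rewrite !inE eqxx.
  by apply: inD e iN _; rewrite !inE eqxx ?orbT.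
have d2 : - (4 * S - 2) <= x <= - (3 * S + 1) -> mD.
  move=> rx; pose i := (`|x|%N - 3 * s - 1)%N; have iN : (i < N)%N by lia.
  have e : x = - (3 * S + i%:Z + 1) by lia.
  by apply: inD e iN _; rewrite !inE eqxx ?orbT.
have d3 : 4 * S + 3 <= x <= 5 * S -> mD.
  move=> rx; pose i := (5 * s - `|x|)%N; have iN : (i < N)%N by lia.
  have e : x = 5 * S - i%:Z by lia.
  by apply: inD e iN _; rewrite !inE eqxx ?orbT.
have u1 : 1 <= x <= 2 * S - 4 -> mU.
  move=> rx; pose i := (`|x|%N.-1./2)%N; have iN : (i < N)%N by lia.
  have [e|e] : x = 2 * i%:Z + 2 \/ x = 2 * i%:Z + 1 by lia.
    by apply: inU e iN _; rewrite !inE eqxx.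
  by apply: inU e iN _; rewrite !inE eqxx ?orbT.
have u2 : 5 * S + 1 <= x <= 6 * S - 2 -> mU.
  move=> rx; pose i := (`|x|%N - 5 * s - 1)%N; have iN : (i < N)%N by lia.
  have e : x = 5 * S + i%:Z + 1 by lia.
  by apply: inU e iN _; rewrite !inE eqxx ?orbT.
have u3 : - (3 * S) <= x <= - (2 * S + 3) -> mU.
  move=> rx; pose i := (3 * s - `|x|)%N; have iN : (i < N)%N by lia.
  have e : x = - (3 * S - i%:Z) by lia.
  by apply: inU e iN _; rewrite !inE eqxx ?orbT.
have t1 : 3 * S + 1 <= x <= 4 * S - 2 -> mT.
  move=> rx; pose i := (`|x|%N - 3 * s - 1)%N; have iN : (i < N)%N by lia.
  have e : x = 3 * S + i%:Z + 1 by lia.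
  by apply: inT e iN _; rewrite !inE eqxx ?orbT.
have t2 : 2 * S + 2 <= x <= 3 * S - 1 -> mT.
  move=> rx; pose i := (3 * s - `|x| - 1)%N; have iN : (i < N)%N by lia.
  have e : x = 3 * S - i.+1%:Z by lia.
  by apply: inT e iN _; rewrite !inE eqxx ?orbT.
have b1 : - (6 * S - 2) <= x <= - (5 * S + 1) -> mB.
  move=> rx; pose i := (`|x|%N - 5 * s - 1)%N; have iN : (i < N)%N by lia.
  have e : x = - (5 * S + i%:Z + 1) by lia.
  by apply: inB e iN _; rewrite !inE eqxx ?orbT.
have b2 : - (5 * S - 1) <= x <= - (4 * S + 2) -> mB.
  move=> rx; pose i := (5 * s - `|x| - 1)%N; have iN : (i < N)%N by lia.
  have e : x = - (5 * S - i.+1%:Z) by lia.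
  by apply: inB e iN _; rewrite !inE eqxx ?orbT.
clear inD inT inB inU; move: mD mT mB mU d1 d2 d3 u1 u2 u3 t1 t2 b1 b2.
clear - x0 lex ltx s_ge2.
move=> mD mT mB mU d1 d2 d3 u1 u2 u3 t1 t2 b1 b2.
lia.
Qed.

End Log.

(** * The triangle rule for the log *)

Section LogPath.
Local Open Scope ring_scope.
Variable s : nat.
Hypothesis s_ge2 : (2 <= s)%N.
Local Notation S := (s%:Z).
Local Notation V := ('I_(12 * s).+2 + 'I_7)%type.
Local Notation z x := (inl (int_mod s x) : V).
Local Notation X k := (inr (inord k) : V).
Local Notation zs := (residues s).
Local Notation N := (s - 2)%N.

Lemma zs_blocks (f : nat -> seq int) r :
  zs (flatten (map f r)) = flatten (map (fun i => zs (f i)) r).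
Proof. by rewrite /residues map_flatten -map_comp. Qed.

Lemma zs_cat q r : zs (q ++ r) = zs q ++ zs r.
Proof. exact: map_cat. Qed.

(** The starting point [- 3 S] is the last entry, so the path is the whole cycle. The relation is
    arbitrary because two are decomposed this way: the successor relation, which supplies equations,
    and the triangle rule to be proved. *)
Lemma path_log (e : rel V) : path e (z (- (3 * S))) (log s) =
    [&& e (z (- (3 * S))) (z (2 * S)), e (z (2 * S)) (z (- (4 * S))),
            e (z (- (4 * S))) (z (2 * S + 1)), e (z (2 * S + 1)) (X 0),
            e (X 0) (z (- (2 * S + 1))), e (z (- (2 * S + 1))) (z (6 * S + 1)),
            e (z (6 * S + 1)) (z (4 * S)), e (z (4 * S)) (z (6 * S)),
            e (z (6 * S)) (z (4 * S + 2)),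
            all (fun i => [&& e (z (5 * S - i.+1%:Z)) (z (- (2 * i%:Z + 2))), e (z (- (2 *
        i%:Z + 2))) (z (- (3 * S + i%:Z + 1))), e (z (- (3 * S + i%:Z + 1))) (z (- (2 * i%:Z
        + 1))) & e (z (- (2 * i%:Z + 1))) (z (5 * S - i%:Z))]) (iota 0 N),
            e (z (5 * S)) (z (3 * S)),
            all (fun i => [&& e (z (3 * S - i%:Z)) (z (3 * S + i%:Z + 1)) & e (z (3 * S +
        i%:Z + 1)) (z (3 * S - i.+1%:Z))]) (iota 0 N),
            e (z (2 * S + 2)) (z (- (2 * S - 3))), e (z (- (2 * S - 3))) (X 1),
            e (X 1) (z (- (2 * S - 1))), e (z (- (2 * S - 1))) (X 2), e (X 2) (z (2 * S -
        1)),
            e (z (2 * S - 1)) (X 3), e (X 3) (z (2 * S - 3)), e (z (2 * S - 3)) (z (4 * S -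
        1)),
            e (z (4 * S - 1)) (X 4), e (X 4) (z (4 * S + 1)), e (z (4 * S + 1)) (z (6 * S -
        1)),
            e (z (6 * S - 1)) (X 5), e (X 5) (z (- (6 * S - 1))),
            e (z (- (6 * S - 1))) (z (- (2 * S - 2))), e (z (- (2 * S - 2))) (z (- (6 *
        S))),
            e (z (- (6 * S))) (z (- (2 * S))), e (z (- (2 * S))) (z (- (5 * S))),
            all (fun i => [&& e (z (- (5 * S - i%:Z))) (z (- (5 * S + i%:Z + 1))) & e (z (-
        (5 * S + i%:Z + 1))) (z (- (5 * S - i.+1%:Z)))]) (iota 0 N),
            e (z (- (4 * S + 2))) (z (2 * S - 2)), e (z (2 * S - 2)) (z (- (4 * S + 1))),
            e (z (- (4 * S + 1))) (X 6), e (X 6) (z (- (4 * S - 1))),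
            e (z (- (4 * S - 1))) (z (- (2 * S + 2)))
        & all (fun i => [&& e (z (- (3 * S - i.+1%:Z))) (z (2 * i%:Z + 2)), e (z (2 * i%:Z +
        2)) (z (5 * S + i%:Z + 1)), e (z (5 * S + i%:Z + 1)) (z (2 * i%:Z + 1)) & e (z (2 *
        i%:Z + 1)) (z (- (3 * S - i%:Z)))]) (iota 0 N)]
  /\ last (z (- (3 * S))) (log s) = z (- (3 * S)).
Proof.
have e0 (x : int) : x - 0%:Z = x by rewrite subr0.
have [d1 d2] := @path_blocks_rev _ e (fun i => z (5 * S - i%:Z)) (fun i => zs (down_block s i)) N (fun=> erefl).
have [t1 t2] := @path_blocks _ e (fun i => z (3 * S - i%:Z)) (fun i => zs (top_block s i)) N (fun=> erefl).
have [b1 b2] := @path_blocks _ e (fun i => z (- (5 * S - i%:Z))) (fun i => zs (bottom_block s i)) N (fun=> erefl).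
have [u1 u2] := @path_blocks_rev _ e (fun i => z (- (3 * S - i%:Z))) (fun i => zs (up_block s i)) N (fun=> erefl).
have D : 5 * S - N%:Z = 4 * S + 2 by lia.
have T : 3 * S - N%:Z = 2 * S + 2 by lia.
rewrite D T !e0 in d1 d2 t1 t2 b1 b2 u1 u2.
rewrite /log /seg0 /seg5 /seg6 !zs_cat /= !zs_cat !zs_blocks.
move: (flatten (map (fun i => zs (down_block s i)) _)) d1 d2 => fd d1 d2.
move: (flatten (map (fun i => zs (top_block s i)) _)) t1 t2 => ft t1 t2.
move: (flatten (map (fun i => zs (bottom_block s i)) _)) b1 b2 => fb b1 b2.
move: (flatten (map (fun i => zs (up_block s i)) _)) u1 u2 => fu u1 u2.
do 8! rewrite /= ?cat_path ?last_cat ?d2 ?t2 ?b2 ?u2.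
split=> //; rewrite d1 t1 b1 u1 -?andbA /=.
do 9! congr (_ && _).
congr (_ && _); first by apply: eq_all => i; rewrite /= andbT.
do 1! congr (_ && _).
congr (_ && _); first by apply: eq_all => i; rewrite /= andbT.
do 17! congr (_ && _).
congr (_ && _); first by apply: eq_all => i; rewrite /= andbT.
do 5! congr (_ && _).
by apply: eq_all => i; rewrite /= andbT.
Qed.

Lemma int_mod_eq (x y k : int) : x = y + k * (12 * S + 2) -> int_mod s x = int_mod s y.
Proof.
move=> ->; rewrite /int_mod rmorphD rmorphM /= -[RHS]addr0; congr (_ + _).
have -> : 12 * S + 2 = ((12 * s).+2)%:Z by lia.
rewrite -pmulrn (_ : _%:R = 0) ?mulr0 //.
exact: (@pchar_Zp (12 * s).+2 isT).
Qed.

Lemma int_mod_nat (a : 'I_(12 * s).+2) : int_mod s (a : nat)%:Z = a.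
Proof. by rewrite /int_mod -pmulrn natr_Zp. Qed.

Lemma mem_log_int x : x \in ints s -> z x \in log s.
Proof.
have in_zs q : x \in q -> z x \in zs q by exact: map_f.
rewrite /ints /log.
move: (in_zs (segA s)) (in_zs (seg0 s)) (in_zs (seg1 s)) (in_zs (seg2 s)).
move: (in_zs (seg3 s)) (in_zs (seg4 s)) (in_zs (seg5 s)) (in_zs (seg6 s)).
move: (zs (segA s)) (zs (seg0 s)) (zs (seg1 s)) (zs (seg2 s)) (zs (seg3 s)).
move: (zs (seg4 s)) (zs (seg5 s)) (zs (seg6 s)) => a b c d e f g h i1 i2 i3 i4 i5 i6 i7 i8.
rewrite mem_cat => /orP[/i5 hx|]; first by rewrite !(mem_cat, in_cons) hx.
rewrite mem_cat => /orP[/i6 hx|]; first by rewrite !(mem_cat, in_cons) hx ?orbT.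
rewrite mem_cat => /orP[/i7 hx|]; first by rewrite !(mem_cat, in_cons) hx ?orbT.
rewrite mem_cat => /orP[/i8 hx|]; first by rewrite !(mem_cat, in_cons) hx ?orbT.
rewrite mem_cat => /orP[/i1 hx|]; first by rewrite !(mem_cat, in_cons) hx ?orbT.
rewrite mem_cat => /orP[/i2 hx|]; first by rewrite !(mem_cat, in_cons) hx ?orbT.
rewrite mem_cat => /orP[/i3 hx|/i4 hx]; by rewrite !(mem_cat, in_cons) hx ?orbT.
Qed.

Lemma mem_log_neq0 v : v != inl 0 -> v \in log s.
Proof.
case: v => [a|x] v0; last first.
  rewrite -[x]inord_val; case: x {v0} => -[|[|[|[|[|[|[|//]]]]]]] ? /=;
  by rewrite /log !(mem_cat, in_cons) eqxx ?orbT.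
have a0 : (a : nat) != 0%N by apply: contraNneq v0 => a0; apply/eqP; congr inl; exact: val_inj.
have ltm := ltn_ord a.
have [lea|gta] := leqP a (6 * s + 1).
  rewrite -(int_mod_nat a); apply: mem_log_int; apply: mem_ints => //; lia.
rewrite -(int_mod_nat a) (@int_mod_eq _ ((a : nat)%:Z - (12 * S + 2)) 1); last by lia.
by apply: mem_log_int; apply: mem_ints; lia.
Qed.

(** The log meets all 12 s + 8 vertices other than 0 and has exactly that length, so it has no
    repetition. *)
Lemma log_uniq_mem : uniq (log s) /\ forall v, (v \in log s) = (v != inl 0).
Proof.
pose r := enum (predC1 (inl 0 : V)).
have ur : uniq r := enum_uniq _.
have sub : {subset r <= log s} by move=> v; rewrite mem_enum => /mem_log_neq0.
have sz : (size (log s) <= size r)%N.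
  by rewrite size_log // -cardE cardC1 card_sum !card_ord; lia.
split; first exact: leq_size_uniq ur sub sz.
by move=> v; have [_ <-] := uniq_min_size ur sub sz; rewrite mem_enum.
Qed.

Lemma even_12s : ~~ odd (12 * s).
Proof. by rewrite oddM. Qed.

Lemma odd_int_mod (x : int) : odd (int_mod s (2 * x + 1)).
Proof.
have -> : int_mod s (2 * x + 1) = int_mod s x + int_mod s x + 1.
  by rewrite /int_mod -!rmorphD /= -[1 in RHS]/(1%:~R) -rmorphD; congr (_%:~R); lia.
by rewrite !(odd_ordD even_12s) addbb.
Qed.

Local Notation nx := (next (log s)).
Local Notation rule := (triangle_rule twin7 (log s)).

Lemma rule_zz (a b c d : int) : nx (z c) = z d ->
  (exists k, c = b - a + k * (12 * S + 2)) -> (exists k, d = - a + k * (12 * S + 2)) ->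
  rule (z a) (z b).
Proof.
move=> e [k /int_mod_eq ec] [l /int_mod_eq ed].
rewrite -[rule _ _]/(nx (inl (int_mod s b - int_mod s a)) == inl (- int_mod s a)).
have -> : int_mod s b - int_mod s a = int_mod s c by rewrite ec /int_mod rmorphB.
by rewrite e ed /int_mod rmorphN.
Qed.

Lemma rule_zx (a x : int) k l : a = 2 * x + 1 -> twin7 (inord k) = inord l ->
  nx (X l) = z (- a) -> rule (z a) (X k).
Proof.
move=> ea ekl e.
rewrite -[rule _ _]/(nx (inr (twist twin7 (int_mod s a) (inord k))) == inl (- int_mod s a)).
by rewrite /twist ea odd_int_mod ekl e ea /int_mod rmorphN.
Qed.

Lemma rule_xz (b x : int) k l : b = 2 * x + 1 -> twin7 (inord k) = inord l ->
  nx (z (- b)) = X l -> rule (X k) (z b).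
Proof.
move=> eb ekl e.
rewrite -[rule _ _]/(nx (inl (- int_mod s b)) == inr (twist twin7 (int_mod s b) (inord k))).
by rewrite /twist eb odd_int_mod ekl -eb /int_mod -rmorphN e.
Qed.

Lemma twin7E k : (k < 7)%N -> twin7 (inord k) = inord (nth 0%N [:: 0; 3; 2; 1; 6; 5; 4]%N k).
Proof. by move=> k7; rewrite /twin7 inordK. Qed.

Local Ltac modular := first [exists 0; lia | exists 1; lia | exists (-1); lia].
Local Ltac zz f := apply: (rule_zz f); modular.
Local Ltac zx x l f := apply: (@rule_zx _ x _ l); [lia | exact: twin7E | rewrite ?opprK; exact f].
Local Ltac xz x l f := apply: (@rule_xz _ x _ l); [lia | exact: twin7E | rewrite ?opprK; exact f].

(** Modulo 12 s + 2, every instance of the rule is one of the successor equations of the log; those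
    inside a block follow from equations in blocks of the same index in other passages. *)
Lemma log_rule : path.cycle rule (log s).
Proof.
have [ul _] := log_uniq_mem.
have := cycle_next ul; rewrite !(cycle_path (z (- (3 * S)))).
have [eQ el] := path_log rule; have [eN _] := path_log (frel nx); rewrite el eQ eN {eQ eN el}.
move=> /andP[/eqP a1 /andP[/eqP a2 /andP[/eqP a3 /andP[/eqP a4 /andP[/eqP a5 /andP[/eqP a6
  /andP[/eqP a7 /andP[/eqP a8 /andP[/eqP a9 /andP[/allP P2 /andP[/eqP b1 /andP[/allP P1
  +]]]]]]]]]]]].
move=> /andP[/eqP d1 /andP[/eqP d2 /andP[/eqP d3 /andP[/eqP d4 /andP[/eqP d5 /andP[/eqP d6
  /andP[/eqP d7 /andP[/eqP d8 /andP[/eqP d9 /andP[/eqP d10 /andP[/eqP d11 /andP[/eqP d12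
  /andP[/eqP d13 /andP[/eqP d14 /andP[/eqP d15 /andP[/eqP d16 /andP[/eqP d17 /andP[/allP P3
  +]]]]]]]]]]]]]]]]]].
move=> /andP[/eqP g1 /andP[/eqP g2 /andP[/eqP g3 /andP[/eqP g4 /andP[/eqP g5 /allP P4]]]]].
have {}P2 i : i \in iota 0 N ->
    [/\ nx (z (5 * S - i.+1%:Z)) = (z (- (2 * i%:Z + 2))), nx (z (- (2 * i%:Z + 2))) = (z (- (3 * S + i%:Z + 1))), nx (z (- (3 * S + i%:Z + 1))) = (z (- (2 * i%:Z + 1)))
    & nx (z (- (2 * i%:Z + 1))) = (z (5 * S - i%:Z))].
  by move=> /P2 /and4P[/eqP ? /eqP ? /eqP ? /eqP ?].
have {}P1 i : i \in iota 0 N ->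
    nx (z (3 * S - i%:Z)) = (z (3 * S + i%:Z + 1)) /\ nx (z (3 * S + i%:Z + 1)) = (z (3 * S - i.+1%:Z)).
  by move=> /P1 /andP[/eqP ? /eqP ?].
have {}P3 i : i \in iota 0 N ->
    nx (z (- (5 * S - i%:Z))) = (z (- (5 * S + i%:Z + 1))) /\ nx (z (- (5 * S + i%:Z + 1))) = (z (- (5 * S - i.+1%:Z))).
  by move=> /P3 /andP[/eqP ? /eqP ?].
have {}P4 i : i \in iota 0 N ->
    [/\ nx (z (- (3 * S - i.+1%:Z))) = (z (2 * i%:Z + 2)), nx (z (2 * i%:Z + 2)) = (z (5 * S + i%:Z + 1)), nx (z (5 * S + i%:Z + 1)) = (z (2 * i%:Z + 1))
    & nx (z (2 * i%:Z + 1)) = (z (- (3 * S - i%:Z)))].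
  by move=> /P4 /and4P[/eqP ? /eqP ? /eqP ? /eqP ?].
apply/andP; split; first by zz b1.
apply/andP; split; first by zz d16.
apply/andP; split; first by zz a7.
apply/andP; split; first by zx (S + 0) 0%N a5.
apply/andP; split; first by xz (- S - 1) 0%N a4.
apply/andP; split; first by zz a3.
apply/andP; split; first by zz a6.
apply/andP; split; first by zz a2.
apply/andP; split; first by zz d15.
apply/andP; split.
  apply/allP => i iN; have [p1 p2 p3 p4] := P2 i iN; have [q1 q2] := P1 i iN.
  have [r1 r2] := P3 i iN; have [u1 u2 u3 u4] := P4 i iN.
  apply/and4P; split; [by zz r2 | by zz u1 | by zz q1 | by zz u3].
apply/andP; split; first by zz d17.
apply/andP; split.
  apply/allP => i iN; have [p1 p2 p3 p4] := P2 i iN; have [q1 q2] := P1 i iN.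
  have [r1 r2] := P3 i iN; have [u1 u2 u3 u4] := P4 i iN.
  apply/andP; split; [by zz u4 | by zz p2].
apply/andP; split; first by zz g5.
apply/andP; split; first by zx (1 - S) 3%N d7.
apply/andP; split; first by xz (- S) 3%N d6.
apply/andP; split; first by zx (- S) 2%N d5.
apply/andP; split; first by xz (S - 1) 2%N d4.
apply/andP; split; first by zx (S - 1) 1%N d3.
apply/andP; split; first by xz (S - 2) 1%N d2.
apply/andP; split; first by zz d1.
apply/andP; split; first by zx (2 * S - 1) 6%N g4.
apply/andP; split; first by xz (2 * S) 6%N g3.
apply/andP; split; first by zz g2.
apply/andP; split; first by zx (3 * S - 1) 5%N d13.
apply/andP; split; first by xz (- (3 * S)) 5%N d12.
apply/andP; split; first by zz d11.
apply/andP; split; first by zz g1.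
apply/andP; split; first by zz a8.
apply/andP; split; first by zz a1.
apply/andP; split.
  apply/allP => i iN; have [p1 p2 p3 p4] := P2 i iN; have [q1 q2] := P1 i iN.
  have [r1 r2] := P3 i iN; have [u1 u2 u3 u4] := P4 i iN.
  apply/andP; split; [by zz p4 | by zz u2].
apply/andP; split; first by zz a9.
apply/andP; split; first by zz d14.
apply/andP; split; first by zx (- (2 * S) - 1) 4%N d10.
apply/andP; split; first by xz (- (2 * S)) 4%N d9.
apply/andP; split; first by zz d8.
apply/allP => i iN; have [p1 p2 p3 p4] := P2 i iN; have [q1 q2] := P1 i iN.
have [r1 r2] := P3 i iN; have [u1 u2 u3 u4] := P4 i iN.
apply/and4P; split; [by zz q2 | by zz p1 | by zz r1 | by zz p3].
Qed.

End LogPath.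

(** * Rows of the letters *)

Lemma coprime_pow2 m n k e : odd n -> (m + 2 ^ e = k * n \/ m = k * n + 2 ^ e)%N ->
  coprime m n.
Proof.
move=> on eq; have dn := dvdn_gcdr m n; have dm := dvdn_gcdl m n.
have dk := dvdn_mull k dn.
have d2 : gcdn m n %| 2 ^ e.
  case: eq => eq; first by rewrite -(dvdn_addr _ dm) eq.
  by rewrite -(dvdn_addr _ dk) -eq.
have : gcdn m n %| gcdn (2 ^ e) n by rewrite dvdn_gcd d2.
have /eqP-> : coprime (2 ^ e) n by rewrite coprimeXl // coprime2n.
by rewrite dvdn1.
Qed.

Section LetterRows.
Local Open Scope ring_scope.
Variables (p : nat) (even_p : ~~ odd p).
Local Notation G := ('I_p.+2).
Variables (T : finType) (f : G + T -> G + T).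

Lemma unit_step_connect (a : G) : a \is a GRing.unit ->
  (forall j, f (inl j) = inl (j + a)) -> forall j k, fconnect f (inl j) (inl k).
Proof.
move=> ua fE j k; have it n : iter n f (inl j) = inl (j + a *+ n).
  by elim: n => [|n IHn]; rewrite ?mulr0n ?addr0 // iterS IHn fE mulrSr addrA.
have <- : iter (nat_of_ord ((k - j) / a)) f (inl j) = inl k.
  by rewrite it -mulr_natl natr_Zp divrK // addrC subrK.
exact: fconnect_iter.
Qed.

(** Two steps together add 2 or -2 and so reach all vertices of the same parity; a single step
    changes the parity. *)
Lemma two_step_connect (a b : G) : odd a -> odd b -> a + b = 2%:R \/ a + b = - 2%:R ->
  (forall j, f (inl j) = inl (j + if odd j then b else a)) ->
  forall j k, fconnect f (inl j) (inl k).
Proof.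
move=> oa ob ab fE.
have f2 j : f (f (inl j)) = inl (j + (a + b)).
  rewrite !fE odd_ordD //; case: (odd j); rewrite ?oa ?ob /= -addrA //.
  by rewrite [b + a]addrC.
have it n j : iter (n + n)%N f (inl j) = inl (j + (a + b) *+ n).
  elim: n => [|n IHn]; first by rewrite mulr0n addr0.
  by rewrite addSn addnS !iterS IHn f2 mulrSr -addrA.
have half (d : G) : odd d = false -> 2%:R *+ (d : nat)./2 = d.
  move=> od; rewrite -mulrnA mul2n -[RHS]natr_Zp; congr (_ *+ _).
  by rewrite -[RHS]odd_double_half od.
have same (j k : G) : odd j = odd k -> fconnect f (inl j) (inl k).
  move=> ojk; case: ab => e.
    have <- : iter ((nat_of_ord (k - j)%R)./2 + (nat_of_ord (k - j)%R)./2)%N f (inl j) = inl k.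
      rewrite it e half; first by rewrite addrC subrK.
      by rewrite odd_ordD // odd_ordN // ojk addbb.
    exact: fconnect_iter.
  have <- : iter ((nat_of_ord (j - k)%R)./2 + (nat_of_ord (j - k)%R)./2)%N f (inl j) = inl k.
    rewrite it e mulNrn half; first by rewrite opprB addrC subrK.
    by rewrite odd_ordD // odd_ordN // ojk addbb.
  exact: fconnect_iter.
move=> j k; case: (eqVneq (odd j) (odd k)) => [|ne]; first exact: same.
apply: connect_trans (fconnect1 f (inl j)) _; rewrite fE; apply: same.
by rewrite odd_ordD //; case: (odd j) (odd k) ne => [] []; rewrite ?oa ?ob.
Qed.

End LetterRows.

Section LogRows.
Local Open Scope ring_scope.
Variable s : nat.
Hypothesis s_ge2 : (2 <= s)%N.
Local Notation S := (s%:Z).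
Local Notation V := ('I_(12 * s).+2 + 'I_7)%type.
Local Notation z x := (inl (int_mod s x) : V).
Local Notation X k := (inr (inord k) : V).
Local Notation nx := (next (log s)).
Local Notation t := (base_rot twin7 (log s)).

Let ul : uniq (log s) := (log_uniq_mem s_ge2).1.
Let ml := (log_uniq_mem s_ge2).2.

Definition before_letter : seq int :=
  [:: 2 * S + 1; - (2 * S - 3); - (2 * S - 1); 2 * S - 1; 4 * S - 1; 6 * S - 1; - (4 * S + 1)].

Lemma prev_letter (x : 'I_7) : prev (log s) (inr x) = z (nth 0 before_letter x).
Proof.
have := cycle_next ul; rewrite (cycle_path (z (- (3 * S)))).
have [eN el] := path_log s_ge2 (frel nx); rewrite el eN.
move=> /andP[_ /andP[_ /andP[_ /andP[/eqP p0 /andP[_ /andP[_ /andP[_ /andP[_ /andP[_]]]]]]]]].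
move=> /andP[_ /andP[_ /andP[_ /andP[_ /andP[/eqP p1 /andP[_ /andP[/eqP p2 /andP[_]]]]]]]].
move=> /andP[/eqP p3 /andP[_ /andP[_ /andP[/eqP p4 /andP[_ /andP[_ /andP[/eqP p5 +]]]]]]].
move=> /andP[_ /andP[_ /andP[_ /andP[_ /andP[_ /andP[_ /andP[_ /andP[_ /andP[/eqP p6 _]]]]]]]]].
have pE y k : nx y = X k -> (k < 7)%N -> x = k :> nat -> prev (log s) (inr x) = y.
  move=> e k7 xk; have -> : x = inord k by apply: val_inj; rewrite /= inordK.
  by rewrite -e (prev_next ul).
case: x pE => -[|[|[|[|[|[|[|//]]]]]]] /= ltx pE; apply: pE (erefl _) => //.
Qed.

Lemma letter_row x j :
  t (inr x) (inl j) = inl (j + int_mod s (nth 0 before_letter (twist twin7 j x))).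
Proof.
by rewrite -[LHS]/(shift twin7 j (prev (log s) (inr (twist twin7 j x)))) prev_letter.
Qed.

Lemma unit_int_mod n k e : odd n ->
  (12 * s + 2 + 2 ^ e = k * n \/ 12 * s + 2 = k * n + 2 ^ e)%N ->
  int_mod s n%:Z \is a GRing.unit.
Proof.
move=> on eq; rewrite /int_mod -pmulrn.
have := @unitZpE (12 * s).+2 n isT; rewrite -[Zp_trunc _]/(12 * s)%N => ->.
by rewrite -addn2; apply: coprime_pow2 eq.
Qed.

(** The letters 0, 2, 5 are their own twins and advance by a unit up to sign: 12 s + 2 differs from
    multiples of 2 s + 1, 2 s - 1, 6 s - 1 by 4, 8, 4. The other letters alternate between two odd
    steps, with sum 2 for the twins 1, 3 and -2 for 4, 6. *)
Lemma letter_row_connect (x : 'I_7) j k : fconnect (t (inr x)) (inl j) (inl k).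
Proof.
have even_p := even_12s s.
have twin_val (i : 'I_7) : twin7 i = nth 0%N [:: 0; 3; 2; 1; 6; 5; 4]%N i :> nat.
  by rewrite inordK //; case: i => -[|[|[|[|[|[|[|//]]]]]]].
have fixed : twin7 x = x -> forall j', t (inr x) (inl j') =
    inl (j' + int_mod s (nth 0 before_letter x)).
  by move=> tx j'; rewrite letter_row /twist tx if_same.
have moved j' : t (inr x) (inl j') = inl (j' + if odd j'
    then int_mod s (nth 0 before_letter (twin7 x)) else int_mod s (nth 0 before_letter x)).
  by rewrite letter_row /twist; case: ifP.
have unitN (y : int) : int_mod s (- y) = - int_mod s y by rewrite /int_mod rmorphN.
have odd2 (y y' : int) : y = 2 * y' + 1 -> odd (int_mod s y).
  by move=> ->; exact: odd_int_mod.
rewrite twin_val in moved.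
have sum_pm2 (y y' : int) : y + y' = 2 \/ y + y' = - 2 ->
    int_mod s y + int_mod s y' = 2%:R \/ int_mod s y + int_mod s y' = - 2%:R.
  by rewrite /int_mod -rmorphD => -[->|->]; [left | right; rewrite rmorphN].
case: x fixed moved twin_val => -[|[|[|[|[|[|[|//]]]]]]] /= ltx fixed moved twin_val.
- apply: (unit_step_connect _ (fixed _)).
    rewrite (_ : 2 * S + 1 = (2 * s + 1)%N%:Z); last by lia.
    by apply: (@unit_int_mod _ 6 2); [rewrite addn1 /= oddM | left; lia].
  by apply: val_inj; rewrite /= twin_val.
- apply: (two_step_connect even_p _ _ _ moved).
  + by apply: (odd2 _ (1 - S)); lia.
  + by apply: (odd2 _ (S - 1)); lia.
  + by apply: sum_pm2; left; lia.
- apply: (unit_step_connect _ (fixed _)).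
    rewrite unitN unitrN (_ : 2 * S - 1 = (2 * s - 1)%N%:Z); last by lia.
    by apply: (@unit_int_mod _ 6 3); [lia | right; lia].
  by apply: val_inj; rewrite /= twin_val.
- apply: (two_step_connect even_p _ _ _ moved).
  + by apply: (odd2 _ (S - 1)); lia.
  + by apply: (odd2 _ (1 - S)); lia.
  + by apply: sum_pm2; left; lia.
- apply: (two_step_connect even_p _ _ _ moved).
  + by apply: (odd2 _ (2 * S - 1)); lia.
  + by apply: (odd2 _ (- (2 * S) - 1)); lia.
  + by apply: sum_pm2; right; lia.
- apply: (unit_step_connect _ (fixed _)).
    rewrite (_ : 6 * S - 1 = (6 * s - 1)%N%:Z); last by lia.
    by apply: (@unit_int_mod _ 2 2); [lia | right; lia].
  by apply: val_inj; rewrite /= twin_val.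
- apply: (two_step_connect even_p _ _ _ moved).
  + by apply: (odd2 _ (- (2 * S) - 1)); lia.
  + by apply: (odd2 _ (2 * S - 1)); lia.
  + by apply: sum_pm2; right; lia.
Qed.

Lemma segment_rot (i k : 'I_7) (q : seq int) :
  path (frel nx) (inr i) (rcons (residues s q) (inr k)) ->
  exists2 b, nx (inr i) = inl b & exists r : seq 'I_(12 * s).+2,
    fpath (t (inl 0)) (inl b) (rcons (map inl r) (inr k)).
Proof.
have tE : t (inl 0) =1 nx by move=> v; rewrite /= oppr0 !shift0.
case: q => [|x q].
  (* The triangle rule forbids two consecutive letters, so the run is not empty. *)
  rewrite -[path _ _ _]/((nx (inr i) == inr k) && true) => /andP[/eqP e _].
  have := next_rule ml (log_rule s_ge2) (isT : inr i != inl 0 :> V).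
  by rewrite e.
rewrite -[path _ _ _]/((nx (inr i) == z x) && path (frel nx) (z x) (rcons (residues s q) (inr k))).
move=> /andP[/eqP e px]; exists (int_mod s x) => //; exists (map (int_mod s) q).
rewrite -map_comp -[map _ q]/(residues s q); apply: sub_path px => u v /eqP <-.
by apply/eqP; exact: tE.
Qed.

Lemma log_segment (i : 'I_7) :
  exists2 b, nx (inr i) = inl b & exists r : seq 'I_(12 * s).+2,
    fpath (t (inl 0)) (inl b) (rcons (map inl r) (inr (ordS i))).
Proof.
have := cycle_next ul; rewrite (cycle_path (z (- (3 * S)))).
have [_ el] := path_log s_ge2 (frel nx); rewrite el; move: el; rewrite /log.
have lastE a q0 q1 q2 q3 q4 q5 q6 q7 : last a (q0 ++ X 0 :: q1 ++ X 1 :: q2 ++ X 2 :: q3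
    ++ X 3 :: q4 ++ X 4 :: q5 ++ X 5 :: q6 ++ X 6 :: q7) = last (X 6) q7.
  by rewrite !(last_cat, last_cons).
rewrite lastE.
have rc (k : nat) (x : V) (q r : seq V) : path (frel nx) x (q ++ X k :: r) ->
    path (frel nx) x (rcons q (X k)) /\ path (frel nx) (X k) r.
  by rewrite cat_path rcons_path => /andP[-> /andP[]].
move=> el /rc[s6 /rc[s0 /rc[s1 /rc[s2 /rc[s3 /rc[s4 /rc[s5 s6']]]]]]].
have {}s6 : path (frel nx) (X 6) (rcons (residues s (seg6 s ++ segA s)) (X 0)).
  by rewrite zs_cat rcons_cat cat_path s6' el.
have ordE (k l : nat) (lk : (k < 7)%N) : l = (k.+1 %% 7)%N ->
    inr (ordS (Ordinal lk)) = X l :> V.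
  by move=> ->; congr inr; apply: val_inj; rewrite /= inordK // ltn_pmod.
have ordE' (k : nat) (lk : (k < 7)%N) : inr (Ordinal lk) = X k :> V.
  by congr inr; apply: val_inj; rewrite /= inordK.
case: i => -[|[|[|[|[|[|[|//]]]]]]] lti; apply: segment_rot; rewrite ordE' (ordE _ _ _ (erefl _));
  eassumption.
Qed.

(** The default 0 never occurs, since by [log_segment] each letter is followed by a group vertex. *)
Definition after_letter (i : 'I_7) : 'I_(12 * s).+2 := if nx (inr i) is inl b then b else 0.

Lemma log_map : exists M : cmap,
  [/\ is_map M, forall k, (k < 12 * s + 9)%N -> kconnected k (graph_of M),
      simple_map (dual M), exists f : graph_of (dual M), one_cut f
    & has_genus M (12 * (s * s) + 11 * s + 6)].
Proof.
have even_p := even_12s s.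
have twinK : involutive twin7.
  move=> x; rewrite -[x]inord_val.
  by case: x => -[|[|[|[|[|[|[|//]]]]]]] ? /=; rewrite !twin7E.
have rule := log_rule s_ge2.
have [|||||||||M [mapM connM simM cutM [cV cD cF]]] :=
  @surgery_map 'I_(12 * s).+2 0 t after_letter.
- exact: base_rot_inj.
- exact: base_rot_diag.
- exact: base_rot_trans.
- exact: base_rot_letter.
- by [].
- exact: letter_row_connect.
- exact: base_rot_tri.
- move=> i; rewrite -[LHS]/(shift twin7 0 (nx (shift twin7 (- 0) (inr i)))) oppr0 !shift0.
  rewrite /after_letter.
  by have [b -> _] := log_segment i.
- move=> i; have [b eb [r pr]] := log_segment i.
  by exists r; rewrite /after_letter eb.
exists M; rewrite card_ord in cV cD connM.
split=> // [k ltk|]; first by apply: connM; lia.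
(* With D = (12 s + 9)(12 s + 8) darts, 2 E = D and 3 F + 21 = D, which determines the genus. *)
rewrite /has_genus cV; have := card_edges M; rewrite cD in cF *; nia.
Qed.

End LogRows.

(** * Comparison with the minimum genus *)

Lemma least_exists (P : nat -> Prop) n : P n -> exists2 g, is_least P g & g <= n.
Proof.
elim: n {-2}n (leqnn n) => [|k IHk] n len Pn.
  by exists n => //; split=> // h _; move: len; rewrite leqn0 => /eqP->.
(* [P] need not be decidable, hence the excluded middle. *)
case: (classic (exists2 h, P h & h < n)) => [[h Ph lth]|none].
  have [|g lg leg] := IHk h _ Ph; first by rewrite -ltnS (leq_trans lth).
  by exists g => //; exact: leq_trans leg (ltnW lth).
exists n => //; split=> // h Ph; rewrite leqNgt; apply/negP => lth.
by apply: none; exists h.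
Qed.

Lemma giso_refl G : giso G G.
Proof. by exists id => //; exists id. Qed.

Theorem theorem4 (s : nat) (hs : 2 <= s) :
  exists d g : nat,
    [/\ is_delta1 (12 * s + 8) d, is_gmin (12 * s + 8) g & d <= g + 3].
Proof.
have [M [mapM connM simM cutM genM]] := log_map hs.
have kM : kconnected (12 * s + 8) (graph_of M) by apply: connM; lia.
set g0 := 12 * (s * s) + 11 * s + 6 in genM.
have [d ld led] : exists2 d, is_delta1 (12 * s + 8) d & d <= g0.
  by apply: least_exists; exists M.
have [g lg _] : exists2 g, is_gmin (12 * s + 8) g & g <= g0.
  apply: least_exists; exists (graph_of M); split=> //.
  by exists M, g0; split=> //; exact: giso_refl.
exists d, g; split=> //.
have [[G [kG eG]] _] := lg.
have k6 : 6 <= 12 * s + 8 by lia.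
(* The bound reads 12 g >= (12 s + 6)(12 s + 5), that is g >= 12 s^2 + 11 s + 5/2. Integrality
   raises this to 12 s^2 + 11 s + 3, which is [g0 - 3]. *)
have := genus_ge k6 kG eG; rewrite /g0 in led; nia.
Qed.
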